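(* Let $\Gamma$ be a quantum graph with $N$ finite edges of the lengths $l_i$, $M$ infinite (semi-infinite) edges, and the coupling described by the unitary matrix $U = \left(\begin{array}{cc}U_1 &U_2 \\ U_3 & U_4 \end{array}\right)$, where $U_4$ corresponds to the coupling between the infinite edges. Let $k_0$ satisfy $\mathrm{det}\,[(1-k_0)U_4 - (1+k_0) I]\not = 0$ and let $k_0$ be a pole of the resolvent $(H - \lambda \,\mathrm{id})^{-1}$ of multiplicity $d$. Let $\Gamma_\varepsilon$ be a geometrically perturbed quantum graph with the edges of lengths $l_i(1+\varepsilon_i)$ and the same coupling as $\Gamma$, where $\vec\varepsilon=(\varepsilon_1,\dots,\varepsilon_N)$. Then there exists an $\varepsilon_0 >0$ such that for all $\vec\varepsilon$ in the open ball of radius $\varepsilon_0$ centred at $0$ the sum of multiplicities of the resolvent poles of $\Gamma_\varepsilon$ in a sufficiently small neighbourhood of $k_0$ is $d$.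
   Context: The Hamiltonian $H$ acts as $-\mathrm{d}^2/\mathrm{d}x^2$ on each edge of the graph, with domain consisting of $W^{2,2}$ functions satisfying the vertex coupling conditions $(U-I)\Psi+i(U+I)\Psi'=0$, where $\Psi,\Psi'$ are the vectors of boundary values and outward derivatives at all edge ends (all vertices merged into a single vertex with the block-diagonal coupling matrix $U$ encoding the graph topology); $U_1$ is the $2N\times 2N$ block referring to the ends of the finite edges, $U_4$ the $M\times M$ block referring to the infinite edges, $U_2,U_3$ the connecting blocks. Resolvent poles (resonances, in the lower complex half-plane of the momentum variable $k$, with energy $k^2$, obtained by analytic continuation / exterior complex scaling; they coincide with poles of the scattering matrix) are the solutions $k$ of $\mathrm{det}\,[(U-I)C_1(k)+ik(U+I)C_2(k)]=0$, where $C_1(k)=\mathrm{diag}(C_1^{(1)}(k),\dots,C_1^{(N)}(k),I_{M\times M})$, $C_2(k)=\mathrm{diag}(C_2^{(1)}(k),\dots,C_2^{(N)}(k),iI_{M\times M})$, $C_1^{(j)}(k)=\begin{pmatrix}0&1\\ \sin kl_j&\cos kl_j\end{pmatrix}$, $C_2^{(j)}(k)=\begin{pmatrix}1&0\\ -\cos kl_j&\sin kl_j\end{pmatrix}$. Equivalently, eliminating the external edges gives the effective energy-dependent coupling $\tilde U(k)=U_1-(1-k)U_2[(1-k)U_4-(k+1)I]^{-1}U_3$ on the compact part, which is defined when $(1-k)U_4-(k+1)I$ is regular. The multiplicity of a pole is its multiplicity as a zero in $k$ of this determinant, regarded as a function $F(k,\vec\varepsilon)$ holomorphic in $k$ and continuous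 in the length perturbation $\vec\varepsilon$. *)

(* Defs.v *)
From HB Require Import structures.
From mathcomp Require Import all_boot all_order all_algebra.
From mathcomp Require Import all_classical all_reals all_analysis.
From mathcomp Require Import complex.
Set Implicit Arguments. Unset Strict Implicit. Unset Printing Implicit Defensive.
Import Order.TTheory GRing.Theory Num.Theory.
Local Open Scope ring_scope.
Local Open Scope complex_scope.

Section QG.
Variable R : realType.
Local Notation C := R[i].

Definition rcosh (y : R) : R := (expR y + expR (- y)) / 2.
Definition rsinh (y : R) : R := (expR y - expR (- y)) / 2.
Definition csin (z : C) : C :=
  let: x +i* y := z in (sin x * rcosh y) +i* (cos x * rsinh y).
Definition ccos (z : C) : C :=
  let: x +i* y := z in (cos x * rcosh y) +i* (- (sin x * rsinh y)).

Definition unitary_mx n (U : 'M[C]_n) : Prop :=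
  U *m (map_mx Num.conj U)^T = 1%:M.

(* Block-diagonal 2N x 2N matrix whose j-th 2x2 block (rows/cols 2j, 2j+1)
   is  B j  (given as a function of the local indices 0/1). *)
Definition blockdiag2 N (B : 'I_N -> bool -> bool -> C) : 'M[C]_(2 * N) :=
  \matrix_(i < 2 * N, j < 2 * N)
    (if ((i %/ 2) == (j %/ 2))%N
     then (if (i %/ 2 < N)%N =P true is ReflectT H
           then B (Ordinal H) (odd i) (odd j) else 0)
     else 0).

Definition C1blk (k lj : C) (a b : bool) : C :=
  match a, b with
  | false, false => 0
  | false, true => 1
  | true, false => csin (k * lj)
  | true, true => ccos (k * lj)
  end.
Definition C2blk (k lj : C) (a b : bool) : C :=
  match a, b with
  | false, false => 1
  | false, true => 0
  | true, false => - ccos (k * lj)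
  | true, true => csin (k * lj)
  end.

Definition C1mx N M (l : 'I_N -> R) (k : C) : 'M[C]_(2 * N + M) :=
  block_mx (blockdiag2 (fun j => C1blk k (l j)%:C)) 0 0 1%:M.
Definition C2mx N M (l : 'I_N -> R) (k : C) : 'M[C]_(2 * N + M) :=
  block_mx (blockdiag2 (fun j => C2blk k (l j)%:C)) 0 0 ('i *: 1%:M).

Definition res_det N M (U : 'M[C]_(2 * N + M)) (l : 'I_N -> R) (k : C) : C :=
  \det ((U - 1%:M) *m C1mx M l k + ('i * k) *: ((U + 1%:M) *m C2mx M l k)).

Definition perturbed_lengths N (l : 'I_N -> R) (eps : 'rV[R]_N) : 'I_N -> R :=
  fun j => l j * (1 + eps 0 j).

Definition cdifferentiable (g : C -> C) (w : C) : Prop :=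
  exists L : C, forall e : R, 0 < e -> exists d : R, 0 < d /\
    forall h : C, h != 0 -> `|h| < d%:C -> `|(g (w + h) - g w) / h - L| < e%:C.

Definition zero_order (f : C -> C) (z : C) (m : nat) : Prop :=
  exists g : C -> C, exists r : R, 0 < r /\ g z != 0 /\
    forall w : C, `|w - z| < r%:C -> f w = (w - z) ^+ m * g w /\ cdifferentiable g w.

Definition zeros_mult_sum (f : C -> C) (k0 : C) (delta : R) (d : nat) : Prop :=
  exists s : seq (C * nat),
    uniq (map fst s) /\
    (forall p, p \in s -> `|p.1 - k0| < delta%:C /\ (0 < p.2)%N /\ zero_order f p.1 p.2) /\
    (forall k : C, `|k - k0| < delta%:C -> f k = 0 -> k \in map fst s) /\
    sumn (map snd s) = d.

End QG.

(* Main.v *)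
(* Write [F eps] for the perturbed secular determinant. It is a polynomial in [k] and in the
   exponentials [exp (+- i k l_j (1 + eps_j))], so it is controlled by iterated divided
   differences, and no Cauchy integral is needed.

   Say that [f] is of class (n, B) on a disc if [f] is bounded by [B] there and, for every [z]
   of the disc, [f w - f z = (w - z) g w] with [g] of class (n - 1, B). These classes are stable
   under sums and products, and contain the power series with bounded coefficients; hence they
   contain the exponentials, and [F eps - F 0] is of class (n, eta) with [eta] arbitrarily small.

   Locally [F 0 k = (k - k0)^d g k] with [g k0 <> 0]. If [d > 0], a perturbation
   [f = (k - k0)^d g + e] with [e] of small class has a zero [z] near [k0]: otherwise the
   minimum of [|f|] on a small square is attained inside, where
   [f w = f z + (w - z)^j G w] with [G z <> 0] shows that it can still be decreased.
   Dividing by [k - z] leaves [(k - k0)^(d-1) g + e'] with [e'] again of small class, so after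
   [d] divisions [f = (k - z_1) ... (k - z_d) h] with [h] zero free. *)
Require Import Defs.
From HB Require Import structures.
From mathcomp Require Import all_boot all_order all_algebra.
From mathcomp Require Import all_classical all_reals all_analysis.
From mathcomp Require Import complex ring lra.
Set Implicit Arguments. Unset Strict Implicit. Unset Printing Implicit Defensive.
Import Order.TTheory GRing.Theory Num.Theory.
Import numFieldNormedType.Exports.
Local Open Scope ring_scope.
Local Open Scope complex_scope.
Local Notation nm := ComplexField.Normc.normc.
Local Notation Re := complex.Re.
Local Notation Im := complex.Im.

(** * The modulus of a complex number as a real number *)

Section Modulus.
Variable R : realType.
Implicit Types (z w : R[i]) (x y : R).

Lemma norm_normc z : `|z| = (nm z)%:C.
Proof. by []. Qed.

Lemma nm_ge0 z : 0 <= nm z.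
Proof. by rewrite -ler0c -norm_normc normr_ge0. Qed.

Lemma nm0 : nm (0 : R[i]) = 0.
Proof. exact: ComplexField.Normc.normc0. Qed.

Lemma nm_eq0 z : (nm z == 0) = (z == 0).
Proof.
apply/eqP/eqP => [|->]; [exact: ComplexField.Normc.eq0_normc | exact: nm0].
Qed.

Lemma nm_gt0 z : (0 < nm z) = (z != 0).
Proof. by rewrite lt_def nm_ge0 andbT nm_eq0. Qed.

Lemma nmM z w : nm (z * w) = nm z * nm w.
Proof. exact: ComplexField.Normc.normcM. Qed.

Lemma nmV z : nm z^-1 = (nm z)^-1.
Proof. exact: ComplexField.Normc.normcV. Qed.

Lemma nmN z : nm (- z) = nm z.
Proof. by apply: complexI; rewrite -!norm_normc normrN. Qed.

Lemma nmB z w : nm (z - w) = nm (w - z).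
Proof. by rewrite -nmN opprB. Qed.

Lemma nmD z w : nm (z + w) <= nm z + nm w.
Proof. by rewrite -lecR rmorphD /= -!norm_normc ler_normD. Qed.

Lemma nmD2 z w x y : nm z <= x -> nm w <= y -> nm (z + w) <= x + y.
Proof. by move=> zx wy; apply: le_trans (nmD _ _) (lerD zx wy). Qed.

Lemma nmM2 z w x y : nm z <= x -> nm w <= y -> nm (z * w) <= x * y.
Proof. by move=> zx wy; rewrite nmM ler_pM // nm_ge0. Qed.

Lemma nm_sub_ge z w : nm z - nm w <= nm (z + w).
Proof. by rewrite lerBlDr -{1}(addrK w z) (le_trans (nmD _ _)) // nmN. Qed.

Lemma nm_dist z w : `|nm z - nm w| <= nm (z - w).
Proof.
have h1 := nmD (z - w) w; have h2 := nmD (w - z) z.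
rewrite !subrK (nmB w z) in h1 h2.
by rewrite ler_norml; apply/andP; split; lra.
Qed.

Lemma nm1 : nm (1 : R[i]) = 1.
Proof. exact: ComplexField.Normc.normc1. Qed.

Lemma nmX z n : nm (z ^+ n) = nm z ^+ n.
Proof. by elim: n => [|n IH]; rewrite ?expr0 ?nm1 // !exprS nmM IH. Qed.

Lemma nmR x : nm x%:C = `|x|.
Proof. by rewrite /= expr0n /= addr0 sqrtr_sqr. Qed.

Lemma nm_i : nm ('i : R[i]) = 1.
Proof. by rewrite /= expr0n /= add0r expr1n sqrtr1. Qed.

Lemma nm_Re z : `|Re z| <= nm z.
Proof. by rewrite -lecR normc_ge_Re. Qed.

Lemma nm_Im z : `|Im z| <= nm z.
Proof.
have := nm_Re (z * 'i); rewrite nmM nm_i mulr1 ReiNIm.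
by rewrite normrN.
Qed.

Lemma nm_ReIm z : nm z <= `|Re z| + `|Im z|.
Proof.
rewrite [X in nm X]complexE; apply: le_trans (nmD _ _) _.
by rewrite nmM nm_i mul1r !nmR.
Qed.

End Modulus.

(** * Classes of functions with bounded iterated divided differences on an arbitrary set [D] *)

Section Smooth.
Variable R : realType.
Local Notation C := R[i].
Variable D : C -> Prop.
Implicit Types (f g : C -> C) (A B : R) (n : nat).

(** The quotient [g] may depend on [z], but a single bound [B] serves for all base points and at
    every level. No limit is involved, so [D] need not be open. *)
Fixpoint divdiff_bounded n B f : Prop :=
  (forall w, D w -> nm (f w) <= B) /\
  (if n is n'.+1 then forall z, D z -> exists g,
     divdiff_bounded n' B g /\ forall w, D w -> f w - f z = (w - z) * g w
   else True).
Local Notation S := divdiff_bounded.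

Lemma divdiff_normc n B f : S n B f -> forall w, D w -> nm (f w) <= B.
Proof. by case: n => [|n] []. Qed.

Lemma divdiff_quot n B f : S n.+1 B f -> forall z, D z -> exists g,
  S n B g /\ forall w, D w -> f w - f z = (w - z) * g w.
Proof. by case. Qed.

Lemma divdiff_ext n B f g : (forall w, D w -> f w = g w) -> S n B f -> S n B g.
Proof.
case: n => [|n] fg [fB fq]; (split; first by move=> w Dw; rewrite -fg // fB) => // z Dz.
have [h [hS hq]] := fq z Dz; exists h; split=> // w Dw.
  by rewrite -!fg // hq.
Qed.

Lemma divdiff_weaken n B B' f : B <= B' -> S n B f -> S n B' f.
Proof.
move=> BB'; elim: n f => [|n IH] f [fB fq];
  (split; first by move=> w Dw; exact: le_trans (fB _ Dw) BB') => // z Dz.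
by have [h [/IH hS hq]] := fq z Dz; exists h.
Qed.

Lemma divdiff_pred n B f : S n.+1 B f -> S n B f.
Proof.
elim: n f => [|n IH] f; first by case.
move=> [fB fq]; split=> // z Dz.
by have [h [/IH hS hq]] := fq z Dz; exists h.
Qed.

Lemma divdiff_leq m n B f : (m <= n)%N -> S n B f -> S m B f.
Proof.
elim: n => [|n IH]; first by rewrite leqn0 => /eqP ->.
by rewrite leq_eqVlt => /predU1P[->//|/IH mn /divdiff_pred /mn].
Qed.

Lemma divdiff_cst n B (c : C) : nm c <= B -> S n B (fun=> c).
Proof.
move=> cB; elim: n c cB => [|n IH] c cB; split=> // z Dz.
exists (fun=> 0); split; last by move=> w _; rewrite subrr mulr0.
by apply: IH; rewrite nm0 (le_trans (nm_ge0 c)).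
Qed.

Lemma divdiff_add n A B f g : S n A f -> S n B g -> S n (A + B) (fun w => f w + g w).
Proof.
elim: n f g => [|n IH] f g [fA fq] [gB gq];
  (split; first by move=> w Dw; exact: nmD2 (fA _ Dw) (gB _ Dw)) => // z Dz.
have [h [hS hq]] := fq z Dz; have [k [kS kq]] := gq z Dz.
  exists (fun w => h w + k w); split; first exact: IH.
  by move=> w Dw; rewrite mulrDr -hq // -kq // opprD addrACA.
Qed.

Lemma divdiff_scale n A B (c : C) f :
  nm c <= A -> S n B f -> S n (A * B) (fun w => c * f w).
Proof.
move=> cA; elim: n f => [|n IH] f [fB fq];
  (split; first by move=> w Dw; exact: nmM2 cA (fB _ Dw)) => // z Dz.
have [h [hS hq]] := fq z Dz.
  exists (fun w => c * h w); split; first exact: IH.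
  by move=> w Dw; rewrite mulrCA -hq // mulrBr.
Qed.

(* Leibniz rule: [f w g w - f z g z = (w - z) (f' w g w + f z g' w)]. *)
Lemma divdiff_mul n A B f g : 0 <= A -> 0 <= B ->
  S n A f -> S n B g -> S n (2 ^+ n * (A * B)) (fun w => f w * g w).
Proof.
move=> A0 B0; elim: n f g => [|n IH] f g fS gS.
  by split=> // w Dw; rewrite expr0 mul1r; apply: nmM2; [case: fS => + _ | case: gS => + _]; exact.
split=> [w Dw|z Dz].
  apply: le_trans (nmM2 (divdiff_normc fS Dw) (divdiff_normc gS Dw)) _.
  by rewrite ler_peMl ?mulr_ge0 // exprn_ege1 ?ler1n.
have [h [hS hq]] := divdiff_quot fS Dz; have [k [kS kq]] := divdiff_quot gS Dz.
exists (fun w => h w * g w + f z * k w); split; last first.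
  by move=> w Dw; rewrite mulrDr mulrA -hq // mulrCA -kq //; ring.
have := divdiff_add (IH _ _ hS (divdiff_pred gS)) (divdiff_scale (divdiff_normc fS Dz) kS).
apply: divdiff_weaken; rewrite [leRHS](_ : _ = 2 ^+ n * (A * B) + 2 ^+ n * (A * B)).
  rewrite lerD2l.
  by rewrite ler_peMl ?mulr_ge0 // exprn_ege1 ?ler1n.
by rewrite exprS; ring.
Qed.

Lemma divdiff_lip n B f w z : S n.+1 B f -> D w -> D z ->
  nm (f w - f z) <= B * nm (w - z).
Proof.
move=> fS Dw Dz; have [h [hS hq]] := divdiff_quot fS Dz.
by rewrite hq // mulrC nmM ler_wpM2r ?nm_ge0 // (divdiff_normc hS).
Qed.

(** The sign of [B] is recorded because an empty [D] would not force it, and the product rule needs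
    it. *)
Definition divdiff_smooth n f := exists2 B, 0 <= B & S n B f.

Lemma divdiff_boundedW n B f w : D w -> S n B f -> divdiff_smooth n f.
Proof. by move=> Dw fS; exists B => //; apply: le_trans (divdiff_normc fS Dw); rewrite nm_ge0. Qed.

Lemma smooth_ext n f g : (forall w, D w -> f w = g w) ->
  divdiff_smooth n f -> divdiff_smooth n g.
Proof. by move=> fg [B B0 /(divdiff_ext fg)]; exists B. Qed.

Lemma smooth_leq m n f : (m <= n)%N -> divdiff_smooth n f -> divdiff_smooth m f.
Proof. by move=> mn [B B0 /(divdiff_leq mn)]; exists B. Qed.

Lemma smooth_cst n (c : C) : divdiff_smooth n (fun=> c).
Proof. by exists (nm c); [exact: nm_ge0|exact: divdiff_cst]. Qed.

Lemma smooth_add n f g : divdiff_smooth n f -> divdiff_smooth n g ->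
  divdiff_smooth n (fun w => f w + g w).
Proof. by move=> [A A0 fA] [B B0 gB]; exists (A + B); [exact: addr_ge0|exact: divdiff_add]. Qed.

Lemma smooth_mul n f g : divdiff_smooth n f -> divdiff_smooth n g ->
  divdiff_smooth n (fun w => f w * g w).
Proof.
move=> [A A0 fA] [B B0 gB]; exists (2 ^+ n * (A * B)); last exact: divdiff_mul.
by rewrite !mulr_ge0 // exprn_ge0.
Qed.

Lemma smooth_exp n f m : divdiff_smooth n f -> divdiff_smooth n (fun w => f w ^+ m).
Proof.
move=> fS; elim: m => [|m IH].
  by apply: smooth_ext (smooth_cst n 1) => w _; rewrite expr0.
by apply: smooth_ext (smooth_mul fS IH) => w _; rewrite exprS.
Qed.

Lemma smooth_prod n (I : Type) (s : seq I) (P : pred I) (F : I -> C -> C) :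
  (forall i, divdiff_smooth n (F i)) ->
  divdiff_smooth n (fun w => \prod_(i <- s | P i) F i w).
Proof.
move=> FS; elim: s => [|i s IH].
  by apply: smooth_ext (smooth_cst n 1) => w _; rewrite big_nil.
case Pi: (P i); last by apply: smooth_ext IH => w _; rewrite big_cons Pi.
by apply: smooth_ext (smooth_mul (FS i) IH) => w _; rewrite big_cons Pi.
Qed.

Lemma smooth_sub n (z : C) r : (forall w, D w -> nm (w - z) <= r) ->
  divdiff_smooth n (fun w => w - z).
Proof.
move=> Dr; exists (Num.max r 1); first by rewrite le_max ler01 orbT.
case: n => [|n]; (split; first by move=> w Dw; rewrite le_max Dr) => // y Dy.
exists (fun=> 1); split; first by apply: divdiff_cst; rewrite nm1 le_max lexx orbT.
  by move=> w _; rewrite mulr1; ring.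
Qed.

End Smooth.

(** * Power series with bounded coefficients on the disc of radius 1/2 *)

Section PowerSeries.
Variable R : realType.
Local Notation C := R[i].

(** The intervals centred at [x n] with radius [2 * K / 2 ^+ n] are nested, because the radius drops
    by exactly [K / 2 ^+ n] at each step. The limit is the supremum of their left ends. *)
Lemma geo_cauchy_lim (x : nat -> R) (K : R) :
  (forall n, `|x n.+1 - x n| <= K / 2 ^+ n) ->
  exists L, forall n, `|L - x n| <= 2 * K / 2 ^+ n.
Proof.
move=> xK.
pose y n := x n - 2 * K / 2 ^+ n; pose z n := x n + 2 * K / 2 ^+ n.
have half n : 2 * K / 2 ^+ n.+1 = K / 2 ^+ n.
  by rewrite exprS invfM mulrACA divff ?mul1r // pnatr_eq0.
have dbl n : 2 * K / 2 ^+ n = K / 2 ^+ n + K / 2 ^+ n by rewrite -mulrA mulr_natl mulr2n.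
have yS n : y n <= y n.+1.
  by rewrite /y half dbl; have := xK n; rewrite ler_norml => /andP[]; lra.
have zS n : z n.+1 <= z n.
  by rewrite /z half dbl; have := xK n; rewrite ler_norml => /andP[]; lra.
have ymono : {homo y : m n / (m <= n)%N >-> m <= n}.
  by apply: homo_leq => //; exact: le_trans.
have zmono m n : (m <= n)%N -> z n <= z m.
  by move=> /subnK <-; elim: (n - m)%N => // k; apply: le_trans; exact: zS.
have K0 : 0 <= K by have := xK 0%N; rewrite expr0 divr1; apply: le_trans; rewrite normr_ge0.
have yz n : y n <= z n.
  rewrite /y /z; have : 0 <= 2 * K / 2 ^+ n by rewrite !mulr_ge0 // invr_ge0 exprn_ge0.
  lra.
have yz2 m n : y m <= z n.
  apply: le_trans (ymono _ _ (leq_maxl m n)) _.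
  by apply: le_trans (yz _) (zmono _ _ (leq_maxr m n)).
exists (sup (range y)) => n.
have yub : has_ubound (range y) by exists (z 0%N) => _ [m _ <-].
have h1 : y n <= sup (range y) by apply: ub_le_sup => //; exists n.
have h2 : sup (range y) <= z n.
  by apply: ge_sup => [|_ [m _ <-]//]; exists (y 0%N), 0%N.
by rewrite ler_norml; move: h1 h2; rewrite /y /z => h1 h2; apply/andP; split; lra.
Qed.

Implicit Types (a b : nat -> C) (w z s : C) (B K : R).

Definition psum a w n := \sum_(i < n) a i * w ^+ i.
Definition shift a : nat -> C := fun n => a n.+1.
Definition bounded_by B a := forall n, nm (a n) <= B.
(** Convergence is taken with a geometric rate: bounded coefficients provide it when [nm w <= 2^-1],
    and the later identities are proved by letting such a rate tend to 0. *)
Definition converges_to a w s := exists K, forall n, nm (s - psum a w n) <= K / 2 ^+ n.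

Lemma psumS a w n : psum a w n.+1 = a 0%N + w * psum (shift a) w n.
Proof.
rewrite /psum big_ord_recl expr0 mulr1 mulr_sumr; congr (_ + _).
by apply: eq_bigr => i _; rewrite /= exprS /shift mulrCA.
Qed.

Lemma bounded_shift B a : bounded_by B a -> bounded_by B (shift a).
Proof. by move=> aB n; apply: aB. Qed.

(** A positive [x] would give [x * n <= x * 2 ^ n <= K] for every [n], against the Archimedean
    property. *)
Lemma geo_small (x K : R) : (forall n, x <= K / 2 ^+ n) -> x <= 0.
Proof.
move=> xK; rewrite leNgt; apply/negP => x0.
have K0 : 0 < K by apply: lt_le_trans x0 _; rewrite (le_trans (xK 0%N)) // expr0 divr1.
have [n Kn] : exists n : nat, K / x < n%:R by exists (Num.trunc (K / x)).+1; rewrite Num.Theory.truncnS_gt.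
have := xK n; rewrite ler_pdivlMr ?exprn_gt0 // => xn.
have : x * n%:R <= K.
  apply: le_trans xn; rewrite ler_pM2l // -natrX ler_nat ltnW //; exact: ltn_expl.
by move: Kn; rewrite ltr_pdivrMr // mulrC => /lt_le_trans h /h; rewrite ltxx.
Qed.

Lemma converges_uniq a w s s' : converges_to a w s -> converges_to a w s' -> s = s'.
Proof.
move=> [K sK] [K' sK']; apply/eqP; rewrite -subr_eq0 -nm_eq0 eq_le nm_ge0 andbT.
apply: (@geo_small _ (K + K')) => n; rewrite mulrDl.
have -> : s - s' = (s - psum a w n) + (psum a w n - s') by ring.
by apply: nmD2 => //; rewrite nmB.
Qed.

(** Real and imaginary parts converge separately with error [2 * B / 2 ^+ n] each, whence the factor
    4. *)
Lemma converges_exists B a w : bounded_by B a -> nm w <= 2^-1 ->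
  exists s, forall n, nm (s - psum a w n) <= 4 * B / 2 ^+ n.
Proof.
move=> aB wh.
have step n : nm (psum a w n.+1 - psum a w n) <= B / 2 ^+ n.
  rewrite /psum big_ord_recr /= addrAC subrr add0r; apply: nmM2 (aB _) _.
  by rewrite nmX -exprVn lerXn2r ?nnegrE ?nm_ge0 // invr_ge0.
have [x xK] : exists x, forall n, `|x - Re (psum a w n)| <= 2 * B / 2 ^+ n.
  apply: geo_cauchy_lim => n; apply: le_trans (step n); apply: le_trans (nm_Re _).
  by case: (psum a w n.+1) (psum a w n) => ? ? [].
have [y yK] : exists y, forall n, `|y - Im (psum a w n)| <= 2 * B / 2 ^+ n.
  apply: geo_cauchy_lim => n; apply: le_trans (step n); apply: le_trans (nm_Im _).
  by case: (psum a w n.+1) (psum a w n) => ? ? [].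
exists (x +i* y) => n; apply: le_trans (nm_ReIm _) _.
have := lerD (xK n) (yK n); rewrite -!mulrA -mulrDl -natrD.
by case: (psum a w n) => p q.
Qed.

(** The sum of the series, with default value 0 where it does not converge at the required rate. *)
Definition ev a w : C := xget 0 (converges_to a w : set C).

Lemma ev_eq a w s : converges_to a w s -> ev a w = s.
Proof. by move=> sP; apply: (converges_uniq _ sP); exact: (@xgetI _ 0 (converges_to a w) s sP). Qed.

Lemma ev_psum B a w n : bounded_by B a -> nm w <= 2^-1 ->
  nm (ev a w - psum a w n) <= 4 * B / 2 ^+ n.
Proof.
move=> aB wh; have [s sP] := converges_exists aB wh.
by rewrite (@ev_eq a w s) //; exists (4 * B).
Qed.

Lemma ev_bound B a w : bounded_by B a -> nm w <= 2^-1 -> nm (ev a w) <= 4 * B.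
Proof.
by move=> aB wh; have := ev_psum 0 aB wh; rewrite /psum big_ord0 subr0 expr0 divr1.
Qed.

Lemma ev_rec B a w : bounded_by B a -> nm w <= 2^-1 ->
  ev a w = a 0%N + w * ev (shift a) w.
Proof.
move=> aB wh; apply: ev_eq; exists (nm (a 0%N + w * ev (shift a) w) + 4 * B) => -[|n].
  rewrite /psum big_ord0 subr0 expr0 divr1 lerDl mulr_ge0 //.
  exact: le_trans (nm_ge0 _) (aB 0%N).
rewrite psumS (_ : _ - _ = w * (ev (shift a) w - psum (shift a) w n)); last by ring.
apply: le_trans (nmM2 wh (ev_psum n (bounded_shift aB) wh)) _.
rewrite exprS invfM [leRHS]mulrCA ler_pM2l ?invr_gt0 //.
by rewrite ler_pM2r ?invr_gt0 ?exprn_gt0 // lerDr nm_ge0.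
Qed.

(** The [n]-th term is the sum over [i] of [a (n + 1 + i) * z ^+ i]. Expanding each
    [(w ^+ m - z ^+ m) / (w - z)] and collecting powers of [w] shows that these are the coefficients
    of the divided difference. *)
Definition quot_coef a z : nat -> C := fun n => ev (iter n.+1 shift a) z.

Lemma quot_coef_shift a z : shift (quot_coef a z) = quot_coef (shift a) z.
Proof. by apply/funext => n; rewrite /shift /quot_coef iterSr. Qed.

Lemma quot_coef_bounded B a z : bounded_by B a -> nm z <= 2^-1 ->
  bounded_by (4 * B) (quot_coef a z).
Proof.
move=> aB zh n; apply: ev_bound => //; elim: n.+1 => // m IH; exact: bounded_shift.
Qed.

(** The defect [E] of the identity satisfies [E b = w * E (shift b)], and it is bounded uniformly
    over all [b] with the same coefficient bound. Iterating with [nm w <= 2^-1] makes it smaller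
    than any [K / 2 ^+ n], so no double series has to be rearranged. *)
Lemma ev_quot B a w z : bounded_by B a -> nm w <= 2^-1 -> nm z <= 2^-1 ->
  ev a w - ev a z = (w - z) * ev (quot_coef a z) w.
Proof.
move=> aB wh zh.
pose E a := ev a w - ev a z - (w - z) * ev (quot_coef a z) w.
have B0 : 0 <= B by apply: le_trans (nm_ge0 _) (aB 0%N).
have Erec b : bounded_by B b -> E b = w * E (shift b).
  move=> bB; rewrite /E (ev_rec bB wh) (ev_rec bB zh).
  rewrite (ev_rec (quot_coef_bounded bB zh) wh) quot_coef_shift.
  by rewrite {1}/quot_coef /=; ring.
have Ebound b n : bounded_by B b -> nm (E b) <= (4 * B + 4 * B + 4 * (4 * B)) / 2 ^+ n.
  elim: n b => [|n IH] b bB.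
    rewrite expr0 divr1 /E; apply: nmD2.
      by apply: nmD2; rewrite ?nmN; exact: ev_bound.
    rewrite nmN -[leRHS]mul1r; apply: nmM2.
      apply: le_trans (nmD2 wh (_ : nm (- z) <= 2^-1)) _; rewrite ?nmN //; lra.
    exact: ev_bound (quot_coef_bounded bB zh) wh.
  rewrite Erec // exprS invfM [leRHS]mulrCA; apply: nmM2 => //.
  by apply: IH; exact: bounded_shift.
apply/eqP; rewrite -subr_eq0 -nm_eq0 eq_le nm_ge0 andbT.
by apply: geo_small => n; exact: (Ebound a n aB).
Qed.

Definition half_disc (c : C) : C -> Prop := fun w => nm (w - c) <= 2^-1.

(** A divided difference is again a power series, with coefficient bound multiplied by 4; one more
    factor 4 comes from evaluating the series. *)
Lemma divdiff_pseries n B a c : bounded_by B a ->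
  divdiff_bounded (half_disc c) n (4 ^+ n.+1 * B) (fun w => ev a (w - c)).
Proof.
elim: n a B => [|n IH] a B aB; (split=> [w Dw|]; last first) => //.
- by rewrite expr1; exact: ev_bound.
- move=> z Dz; exists (fun w => ev (quot_coef a (z - c)) (w - c)); split.
    by rewrite exprSr -mulrA; apply: IH; exact: quot_coef_bounded.
  by move=> w Dw; rewrite (ev_quot aB) //; congr (_ * _); ring.
- apply: le_trans (ev_bound aB Dw) _; rewrite exprS -mulrA ler_pM2l //.
  rewrite ler_peMl ?exprn_ege1 ?ler1n //; exact: le_trans (nm_ge0 _) (aB 0%N).
Qed.

End PowerSeries.

(** * The complex exponential and its relation to [csin] and [ccos] *)

Section ComplexExp.
Variable R : realType.
Local Notation C := R[i].
Implicit Types (u t z w : C) (s : R).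

Definition cexp z : C := (expR (Re z))%:C * (cos (Im z) +i* sin (Im z)).

Lemma nm_cexp z : nm (cexp z) = expR (Re z).
Proof.
by rewrite /cexp nmM nmR ger0_norm ?expR_ge0 //= cos2Dsin2 sqrtr1 mulr1.
Qed.

Lemma cexpD z w : cexp (z + w) = cexp z * cexp w.
Proof.
case: z w => a b [c d]; rewrite /cexp /= expRD cosD sinD.
by simpc; congr (_ +i* _); ring.
Qed.

Lemma cexp0 : cexp 0 = 1.
Proof. by rewrite /cexp /= expR0 cos0 sin0 mul1r. Qed.

Lemma csinE z : csin z = (cexp ('i * z) - cexp (- ('i * z))) / (2 * 'i).
Proof.
have i0 : 2 * 'i != 0 :> C by rewrite mulf_neq0 ?pnatr_eq0 // -complexiE neq0Ci.
apply/eqP; rewrite eq_sym -subr_eq0 -(mulrI_eq0 _ (mulfI i0)) mulrBr subr_eq0.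
rewrite mulrCA mulfV // mulr1; case: z => a b; rewrite /cexp /csin /rcosh /rsinh.
by apply/eqP; simpc; rewrite /= cosN sinN ?opprK; congr (_ +i* _); field.
Qed.

Lemma ccosE z : ccos z = (cexp ('i * z) + cexp (- ('i * z))) / 2.
Proof.
have i0 : 2 != 0 :> C by rewrite pnatr_eq0.
apply/eqP; rewrite eq_sym -subr_eq0 -(mulrI_eq0 _ (mulfI i0)) mulrBr subr_eq0.
rewrite mulrCA mulfV // mulr1; case: z => a b; rewrite /cexp /ccos /rcosh /rsinh.
by apply/eqP; simpc; rewrite /= cosN sinN ?opprK; congr (_ +i* _); field.
Qed.

(** * Componentwise derivatives of complex functions of a real variable, and a mean value bound *)

Definition is_cderive (f : R -> C) s (d : C) :=
  is_derive s 1 (fun x => Re (f x)) (Re d) /\ is_derive s 1 (fun x => Im (f x)) (Im d).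

Lemma is_cderiveD f g s df dg : is_cderive f s df -> is_cderive g s dg ->
  is_cderive (fun x => f x + g x) s (df + dg).
Proof.
have ReD (p q : C) : Re (p + q) = Re p + Re q by case: p q => ? ? [].
have ImD (p q : C) : Im (p + q) = Im p + Im q by case: p q => ? ? [].
move=> [f1 f2] [g1 g2]; split.
  by rewrite ReD (_ : (fun x => _) = (fun x => Re (f x)) + (fun x => Re (g x)));
    [exact: is_deriveD|apply/funext => x; rewrite ReD].
by rewrite ImD (_ : (fun x => _) = (fun x => Im (f x)) + (fun x => Im (g x)));
    [exact: is_deriveD|apply/funext => x; rewrite ImD].
Qed.

Lemma is_cderiveM f g s df dg : is_cderive f s df -> is_cderive g s dg ->
  is_cderive (fun x => f x * g x) s (f s * dg + df * g s).
Proof.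
have ReM (p q : C) : Re (p * q) = Re p * Re q - Im p * Im q by case: p q => ? ? [].
have ImM (p q : C) : Im (p * q) = Re p * Im q + Im p * Re q.
  by case: p q => a b [c d] /=; rewrite addrC.
have ReD (p q : C) : Re (p + q) = Re p + Re q by case: p q => ? ? [].
have ImD (p q : C) : Im (p + q) = Im p + Im q by case: p q => ? ? [].
move=> [f1 f2] [g1 g2]; split.
  rewrite (_ : (fun x => _) = (fun x => Re (f x)) * (fun x => Re (g x)) -
     (fun x => Im (f x)) * (fun x => Im (g x))); last by apply/funext => x; rewrite ReM.
  apply: is_derive_eq; rewrite ReD !ReM /GRing.scale /=; ring.
rewrite (_ : (fun x => _) = (fun x => Re (f x)) * (fun x => Im (g x)) +
     (fun x => Im (f x)) * (fun x => Re (g x))); last by apply/funext => x; rewrite ImM.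
apply: is_derive_eq; rewrite ImD !ImM /GRing.scale /=; ring.
Qed.

Lemma is_cderive_cst (c : C) s : is_cderive (fun=> c) s 0.
Proof. by split; exact: is_derive_cst. Qed.

Lemma is_cderive_line u s : is_cderive (fun x => x%:C * u) s u.
Proof.
case: u => a b; split.
  rewrite (_ : (fun x => _) = (fun x : R => x * a)); last first.
    by apply/funext => x /=; rewrite mul0r subr0.
  by apply: is_derive_eq; rewrite /GRing.scale /= mulr0 add0r mulr1.
rewrite (_ : (fun x => _) = (fun x : R => x * b)); last first.
  by apply/funext => x /=; rewrite mul0r addr0.
by apply: is_derive_eq; rewrite /GRing.scale /= mulr0 add0r mulr1.
Qed.

Lemma is_cderive_cexp u s : is_cderive (fun x => cexp (x%:C * u)) s (u * cexp (s%:C * u)).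
Proof.
case: u => a b.
have h (x : R) : cexp (x%:C * (a +i* b)) =
  (expR (x * a) * cos (x * b)) +i* (expR (x * a) * sin (x * b)).
  by rewrite /cexp; simpc; rewrite /=.
rewrite h; split.
  rewrite (_ : (fun x => _) = (fun x : R => expR (x * a) * cos (x * b))); last first.
    by apply/funext => x; rewrite h.
  have d1 : is_derive s 1 (fun x : R => expR (x * a)) (expR (s * a) * a).
    apply: (@is_derive1_comp _ expR (fun x : R => x * a)).
    by apply: is_derive_eq; rewrite /GRing.scale /= mulr0 add0r mulr1.
  have d2 : is_derive s 1 (fun x : R => cos (x * b)) (- sin (s * b) * b).
    apply: (@is_derive1_comp _ cos (fun x : R => x * b)).
    by apply: is_derive_eq; rewrite /GRing.scale /= mulr0 add0r mulr1.
  have := is_deriveM d1 d2; congr is_derive; rewrite /GRing.scale /=; ring.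
rewrite (_ : (fun x => _) = (fun x : R => expR (x * a) * sin (x * b))); last first.
  by apply/funext => x; rewrite h.
have d1 : is_derive s 1 (fun x : R => expR (x * a)) (expR (s * a) * a).
  apply: (@is_derive1_comp _ expR (fun x : R => x * a)).
  by apply: is_derive_eq; rewrite /GRing.scale /= mulr0 add0r mulr1.
have d2 : is_derive s 1 (fun x : R => sin (x * b)) (cos (s * b) * b).
  apply: (@is_derive1_comp _ sin (fun x : R => x * b)).
  by apply: is_derive_eq; rewrite /GRing.scale /= mulr0 add0r mulr1.
have := is_deriveM d1 d2; congr is_derive; rewrite /GRing.scale /=; ring.
Qed.

(** The real mean value theorem is applied to each component; the two intermediate points may
    differ, which costs the factor 2. *)
Lemma cMVT (f df : R -> C) (K : R) :
  (forall s, is_cderive f s (df s)) -> (forall s, 0 <= s <= 1 -> nm (df s) <= K) ->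
  nm (f 1 - f 0) <= 2 * K.
Proof.
move=> fd dK.
have real_mvt (g dg : R -> R) : (forall s, is_derive s 1 g (dg s)) ->
    (forall s, 0 <= s <= 1 -> `|dg s| <= K) -> `|g 1 - g 0| <= K.
  move=> gd dgK; have gc : {within `[0, 1], continuous g}%classic.
    by apply: derivable_within_continuous => x _; have [] := gd x.
  have [s] := MVT_segment ler01 (fun x _ => gd x) gc.
  by rewrite in_itv /= => /dgK sK ->; rewrite subr0 mulr1.
apply: le_trans (nm_ReIm _) _; rewrite mulr_natl mulr2n; apply: lerD.
  have -> : Re (f 1 - f 0) = Re (f 1) - Re (f 0) by case: (f 1) (f 0) => ? ? [].
  apply: (real_mvt (fun s => Re (f s)) (fun s => Re (df s))) => s; first by have [] := fd s.
  by move=> /dK; apply: le_trans; exact: nm_Re.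
have -> : Im (f 1 - f 0) = Im (f 1) - Im (f 0) by case: (f 1) (f 0) => ? ? [].
apply: (real_mvt (fun s => Im (f s)) (fun s => Im (df s))) => s; first by have [] := fd s.
by move=> /dK; apply: le_trans; exact: nm_Im.
Qed.

(** * Taylor expansion of the exponential, and smallness of [cexp u - 1] *)

Definition ecoef t n : C := t ^+ n / n`!%:R.
Definition etaylor u n : C := \sum_(i < n) ecoef u i.

Lemma ecoefM t w n : ecoef (t * w) n = ecoef t n * w ^+ n.
Proof. by rewrite /ecoef exprMn mulrAC. Qed.

Lemma is_cderive_ecoef u n s :
  is_cderive (fun x => ecoef (x%:C * u) n.+1) s (u * ecoef (s%:C * u) n).
Proof.
elim: n => [|n IH].
  rewrite /ecoef expr0 fact0 divr1 mulr1.
  rewrite (_ : (fun x => _) = (fun x => x%:C * u)); first exact: is_cderive_line.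
  by apply/funext => x; rewrite expr1 divr1.
have := is_cderiveM (is_cderive_cst ((n.+2)%:R)^-1 s) (is_cderiveM (is_cderive_line u s) IH).
have n0 m : m.+1%:R != 0 :> C by rewrite pnatr_eq0.
have f0 m : m`!%:R != 0 :> C by rewrite pnatr_eq0 -lt0n fact_gt0.
congr is_cderive.
  by apply/funext => x; rewrite /ecoef [in RHS]factS natrM invfM [in RHS]exprS; ring.
rewrite /ecoef !factS !natrM exprS -!natr1; field.
by rewrite !natr1 f0 !n0.
Qed.

Lemma is_cderive_etaylor u n s :
  is_cderive (fun x => etaylor (x%:C * u) n.+1) s (u * etaylor (s%:C * u) n).
Proof.
elim: n => [|n IH].
  rewrite /etaylor big_ord0 mulr0.
  rewrite (_ : (fun x => _) = (fun=> 1)); first exact: is_cderive_cst.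
  by apply/funext => x; rewrite big_ord1 /ecoef expr0 fact0 divr1.
have := is_cderiveD IH (is_cderive_ecoef u n s).
congr is_cderive; first by apply/funext => x; rewrite /etaylor [in RHS]big_ord_recr.
by rewrite -mulrDr /etaylor [in RHS]big_ord_recr.
Qed.

Lemma nm_ecoef t n : nm (ecoef t n) = nm t ^+ n / n`!%:R.
Proof. by rewrite /ecoef nmM nmX nmV -(rmorph_nat (real_complex R)) nmR ger0_norm. Qed.

Lemma nm_ecoef_le t n : nm (ecoef t n) <= expR (nm t).
Proof.
rewrite nm_ecoef; case: n => [|n].
  by rewrite expr0 fact0 divr1 -[leLHS]expR0 ler_expR nm_ge0.
by have := expR_ge1Dxn n (nm_ge0 t); lra.
Qed.

Lemma nm_cexp_le z : nm (cexp z) <= expR (nm z).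
Proof. by rewrite nm_cexp ler_expR (le_trans (ler_norm _)) // nm_Re. Qed.

(* The derivative of [s |-> cexp (- s u) * etaylor (s u) n.+1] telescopes to a single
   monomial, so the mean value theorem bounds the Taylor remainder. *)
Lemma cexp_taylor u n :
  nm (cexp u - etaylor u n.+1) <= 2 * (expR (nm u) ^+ 2 * (nm u * nm (ecoef u n))).
Proof.
pose f (s : R) := cexp (s%:C * - u) * etaylor (s%:C * u) n.+1.
pose df (s : R) := - (u * (cexp (s%:C * - u) * ecoef (s%:C * u) n)).
have fd s : is_cderive f s (df s).
  have := is_cderiveM (is_cderive_cexp (- u) s) (is_cderive_etaylor u n s).
  by congr is_cderive; rewrite /df /etaylor big_ord_recr /=; ring.
have dK s : 0 <= s <= 1 -> nm (df s) <= expR (nm u) * (nm u * nm (ecoef u n)).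
  move=> /andP[s0 s1]; rewrite /df nmN nmM [leRHS]mulrCA ler_wpM2l ?nm_ge0 //.
  have su : nm (s%:C * u) <= nm u by rewrite nmM nmR ger0_norm // ler_piMl ?nm_ge0.
  apply: nmM2.
    by apply: le_trans (nm_cexp_le _) _; rewrite ler_expR mulrN nmN.
  rewrite !nm_ecoef ler_pM2r ?invr_gt0 ?ltr0n ?fact_gt0 //.
  by rewrite lerXn2r ?nnegrE ?nm_ge0.
have f0 : f 0 = 1.
  rewrite /f !mul0r cexp0 mul1r /etaylor big_ord_recl big1 ?addr0.
    by rewrite /ecoef expr0 fact0 divr1.
  by move=> i _; rewrite /ecoef /= exprS !mul0r.
have f1 : f 1 = cexp (- u) * etaylor u n.+1 by rewrite /f !mul1r.
have := cMVT fd dK; rewrite f0 f1 => h.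
have -> : cexp u - etaylor u n.+1 = cexp u * - (cexp (- u) * etaylor u n.+1 - 1).
  by rewrite opprB mulrBr mulr1 mulrA -cexpD subrr cexp0 mul1r.
apply: le_trans (nmM2 (nm_cexp_le u) (_ : nm _ <= _)) _; first by rewrite nmN; exact: h.
by rewrite expr2; lra.
Qed.

Lemma ecoef_bounded t : bounded_by (expR (nm t)) (ecoef t).
Proof. by move=> n; exact: nm_ecoef_le. Qed.

Lemma psum_ecoef t w n : psum (ecoef t) w n = etaylor (t * w) n.
Proof. by apply: eq_bigr => i _; rewrite ecoefM. Qed.

Lemma ev_ecoef t w : nm w <= 2^-1 -> ev (ecoef t) w = cexp (t * w).
Proof.
move=> wh; apply: ev_eq.
(* The factor 4 is the 2 of [cexp_taylor] times the 2 lost in passing from [2 ^+ n] to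
   [2 ^+ n.+1]. *)
set u := t * w; pose K := 4 * (expR (nm u) ^+ 2 * (nm u * expR (nm t))).
have K0 : 0 <= K by rewrite !mulr_ge0 ?exprn_ge0 ?expR_ge0 ?nm_ge0.
(* The summand [nm (cexp u)] covers the empty partial sum, which [cexp_taylor] does not reach. *)
exists (K + nm (cexp u)) => -[|n].
  by rewrite /psum big_ord0 subr0 expr0 divr1 lerDr.
rewrite psum_ecoef -/u; apply: le_trans (cexp_taylor u n) _.
apply: (@le_trans _ _ (K / 2 ^+ n.+1)); last first.
  by rewrite ler_pM2r ?invr_gt0 ?exprn_gt0 // lerDl nm_ge0.
have -> : K / 2 ^+ n.+1 = 2 * (expR (nm u) ^+ 2 * (nm u * (expR (nm t) / 2 ^+ n))).
  by rewrite /K (exprS _ n) invfM; set p := (_ ^+ n)^-1; field.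
rewrite ler_pM2l // ler_wpM2l ?exprn_ge0 ?expR_ge0 // ler_wpM2l ?nm_ge0 //.
rewrite ecoefM; apply: nmM2; first exact: nm_ecoef_le.
by rewrite nmX -exprVn lerXn2r ?nnegrE ?nm_ge0.
Qed.

Lemma cexp_smooth n c t : divdiff_smooth (half_disc c) n (fun k => cexp (t * k)).
Proof.
have h : divdiff_smooth (half_disc c) n (fun k => ev (ecoef t) (k - c)).
  exists (4 ^+ n.+1 * expR (nm t)); last exact: divdiff_pseries (ecoef_bounded t).
  by rewrite mulr_ge0 ?exprn_ge0 ?expR_ge0.
apply: smooth_ext (smooth_mul (smooth_cst _ n (cexp (t * c))) h) => k Dk.
by rewrite ev_ecoef // -cexpD; congr cexp; ring.
Qed.

(** Coefficients of [cexp (t * w) - 1]. Without the constant term they are of size [nm t], so that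
    every divided difference tends to 0 with [t]. *)
Definition ecoef1 t n : C := if n is 0 then 0 else ecoef t n.

Lemma ecoef1_bounded t : nm t <= 1 -> bounded_by (nm t) (ecoef1 t).
Proof.
move=> t1 [|n]; rewrite /ecoef1 ?nm0 ?nm_ge0 // nm_ecoef.
rewrite ler_pdivrMr ?ltr0n ?fact_gt0 // exprS.
apply: ler_wpM2l (nm_ge0 _) _ _ _.
by rewrite (@le_trans _ _ 1) ?exprn_ile1 ?nm_ge0 // ler1n fact_gt0.
Qed.

Lemma ev_ecoef1 t w : nm t <= 1 -> nm w <= 2^-1 -> ev (ecoef1 t) w = cexp (t * w) - 1.
Proof.
move=> t1 wh; rewrite -ev_ecoef // (ev_rec (ecoef_bounded t) wh).
rewrite (ev_rec (ecoef1_bounded t1) wh) add0r /ecoef expr0 fact0 divr1.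
by rewrite addrC addKr.
Qed.

Lemma cexp_sub1_bounded n c t : nm t <= 1 ->
  divdiff_bounded (half_disc c) n (4 ^+ n.+1 * nm t) (fun k => cexp (t * (k - c)) - 1).
Proof.
move=> t1; have := divdiff_pseries n c (ecoef1_bounded t1); apply: divdiff_ext => w Dw.
by rewrite ev_ecoef1.
Qed.

Lemma cexp_sub1_le u : nm u <= 2^-1 -> nm (cexp u - 1) <= 8 * nm u.
Proof.
move=> u2; have n2 : nm (2 : C) = 2 by rewrite -(rmorph_nat (real_complex R)) nmR ger0_norm.
(* Writing [u = (2 * u) * 2^-1], the series with parameter [2 * u] is evaluated at [2^-1]; the bound
   [4 * nm (2 * u)] gives the constant 8. *)
have u1 : nm (2 * u) <= 1 by rewrite nmM n2; lra.
have h : nm (2^-1 : C) <= 2^-1 by rewrite nmV n2.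
have := ev_bound (ecoef1_bounded u1) h; rewrite ev_ecoef1 //.
rewrite mulrAC divff ?mul1r ?pnatr_eq0 // nmM n2; lra.
Qed.

End ComplexExp.

(** * Stability of zeros: minimum principle, division by roots, and a Hurwitz theorem *)

Section Hurwitz.
Variable R : realType.
Local Notation C := R[i].
Variable k0 : C.
Local Notation D := (half_disc k0).
Local Notation S := (divdiff_bounded D).
Local Notation smooth := (divdiff_smooth D).
Implicit Types (f g h e : C -> C) (z w k : C).

Lemma half_disc_center : D k0.
Proof. by rewrite /half_disc subrr nm0 invr_ge0. Qed.

(** Chooses one small step meeting two linear constraints. Dividing by [a + 1] and [b + 1] allows
    zero slopes and makes the inequalities strict. *)
Lemma small_scale (a b r c : R) : 0 <= a -> 0 <= b -> 0 < r -> 0 < c ->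
  exists s : R, [/\ 0 < s, s <= 1, s * a < r & s * b < c].
Proof.
move=> a0 b0 r0 c0; pose s := Num.min 1 (Num.min (r / (a + 1)) (c / (b + 1))).
have s0 : 0 < s by rewrite !lt_min ltr01 !divr_gt0 // ltr_wpDl.
have s1 : s * (a + 1) <= r.
  by rewrite -ler_pdivlMr ?ltr_wpDl // !ge_min lexx orbT.
have s2 : s * (b + 1) <= c.
  by rewrite -ler_pdivlMr ?ltr_wpDl // !ge_min lexx !orbT.
exists s; split => //; first by rewrite ge_min lexx.
- by apply: lt_le_trans s1; rewrite ltr_pM2l // ltrDl.
- by apply: lt_le_trans s2; rewrite ltr_pM2l // ltrDl.
Qed.

(* Moving from [z] along a [j]-th root of [- f z / G z] decreases the modulus. *)
Lemma modulus_decrease f G z j (r L : R) : (0 < j)%N -> 0 < r -> 0 <= L ->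
  f z != 0 -> G z != 0 ->
  (forall w, nm (w - z) < r -> f w - f z = (w - z) ^+ j * G w /\
     nm (G w - G z) <= L * nm (w - z)) ->
  exists w, nm (w - z) < r /\ nm (f w) < nm (f z).
Proof.
move=> j0 r0 L0 fz Gz fG.
pose u : C := j.-root (- f z / G z).
have uj : u ^+ j = - f z / G z by rewrite rootCK.
have uG : u ^+ j * G z = - f z by rewrite uj divfK.
have B0 : 0 <= nm u ^+ j * (L * nm u).
  by rewrite !mulr_ge0 ?exprn_ge0 ?nm_ge0.
have fz0 : 0 < nm (f z) by rewrite nm_gt0.
have [s [s0 s1 sr sf]] := small_scale (nm_ge0 u) B0 r0 fz0.
have wz : z + s%:C * u - z = s%:C * u by ring.
have nsu : nm (s%:C * u) = s * nm u by rewrite nmM nmR gtr0_norm.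
exists (z + s%:C * u); rewrite wz nsu; split=> //.
have [] := fG (z + s%:C * u); rewrite wz nsu //; set w := z + _ => fw Gw.
have -> : f w = f z * (1 - s ^+ j)%:C + s%:C ^+ j * (u ^+ j * (G w - G z)).
  have -> : f w = f z + (s%:C * u) ^+ j * G w by rewrite -fw; ring.
  rewrite rmorphB rmorph1 rmorphXn /= exprMn.
  have -> : s%:C ^+ j * (u ^+ j * (G w - G z)) =
    s%:C ^+ j * u ^+ j * G w - s%:C ^+ j * (u ^+ j * G z) by ring.
  by rewrite uG; ring.
have sj : 0 <= s ^+ j <= 1 by rewrite exprn_ge0 ?exprn_ile1 // ltW.
have sj0 : 0 < s ^+ j by rewrite exprn_gt0.
apply: le_lt_trans (nmD _ _) _.
have h1 : nm (f z * (1 - s ^+ j)%:C) = nm (f z) - nm (f z) * s ^+ j.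
  rewrite nmM nmR ger0_norm ?mulrBr ?mulr1 //; by case/andP: sj; rewrite subr_ge0.
have h2 : nm (s%:C ^+ j * (u ^+ j * (G w - G z))) <= s ^+ j * (nm u ^+ j * (L * (s * nm u))).
  rewrite nmM nmX nmR gtr0_norm // ler_pM2l // nmM nmX ler_wpM2l // exprn_ge0 ?nm_ge0 //.
have h3 : s ^+ j * (nm u ^+ j * (L * (s * nm u))) < s ^+ j * nm (f z).
  by rewrite ltr_pM2l //; apply: le_lt_trans sf; rewrite le_eqVlt; apply/orP; left; apply/eqP; ring.
rewrite h1; lra.
Qed.

(** A square is compact as a product of two segments, and [rho <= 4^-1] keeps it inside the disc of
    radius 1/2, since the modulus is at most the sum of the two coordinates. *)
Lemma square_min f (B rho : R) : 0 <= B -> 0 < rho -> rho <= 4^-1 ->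
  (forall w z, D w -> D z -> nm (f w - f z) <= B * nm (w - z)) ->
  exists z, [/\ `|Re (z - k0)| <= rho, `|Im (z - k0)| <= rho &
    forall w, `|Re (w - k0)| <= rho -> `|Im (w - k0)| <= rho -> nm (f z) <= nm (f w)].
Proof.
move=> B0 r0 r4 flip.
pose A := (`[- rho, rho]%classic `*` `[- rho, rho]%classic : set (R * R))%classic.
pose F (p : R * R) := nm (f (k0 + (p.1 +i* p.2))).
have AD p : A p -> D (k0 + (p.1 +i* p.2)).
  rewrite /A /= !in_itv /= -!ler_norml => -[p1 p2]; rewrite /half_disc addrC addKr.
  by apply: le_trans (nm_ReIm _) _ => /=; lra.
have cA : compact A by apply: compact_setX; exact: segment_compact.
have A0 : (A !=set0)%classic.
  by exists (0, 0); split => /=; rewrite in_itv /= oppr_le0 ltW.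
have Fc : {within A, continuous F}%classic.
  apply/subspace_continuousP => p Ap; apply/cvgrPdist_le => eps eps0.
  rewrite /within /=; apply/nbhs_ballP.
  have e0 : 0 < eps / (2 * B + 1) by rewrite divr_gt0 // ltr_wpDl // mulr_ge0.
  exists (eps / (2 * B + 1)) => // q [] /=; rewrite -!ball_normE /= => q1 q2 Aq.
  have := flip _ _ (AD _ Ap) (AD _ Aq).
  have -> : k0 + (p.1 +i* p.2) - (k0 + (q.1 +i* q.2)) = (p.1 - q.1) +i* (p.2 - q.2).
    by rewrite opprD addrACA subrr add0r.
  have := nm_ReIm ((p.1 - q.1) +i* (p.2 - q.2)) => /= hn fl.
  have h4 : `|p.1 - q.1| + `|p.2 - q.2| <= 2 * (eps / (2 * B + 1)) by lra.
  have h5 : B * (2 * (eps / (2 * B + 1))) <= eps.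
    have -> : B * (2 * (eps / (2 * B + 1))) = eps * ((2 * B) / (2 * B + 1)) by ring.
    rewrite ler_piMr ?(ltW eps0) // ler_pdivrMr ?mul1r ?lerDl //; lra.
  apply: le_trans (nm_dist _ _) _; apply: le_trans fl _; apply: le_trans h5.
  by rewrite ler_wpM2l // (le_trans hn h4).
have [p] := compact_EVT_min A0 cA Fc; rewrite inE => Ap pmin.
exists (k0 + (p.1 +i* p.2)).
have := Ap; rewrite /A /= !in_itv /= -!ler_norml => -[p1 p2].
have -> : k0 + (p.1 +i* p.2) - k0 = p.1 +i* p.2 by rewrite addrC addKr.
split=> // w w1 w2.
have := pmin (Re (w - k0), Im (w - k0)); rewrite inE /F /=.
have -> : k0 + ((Re (w - k0)) +i* (Im (w - k0))) = w.
  have eta_c (v : C) : Re v +i* Im v = v by case: v.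
  by rewrite eta_c addrC subrK.
by apply; rewrite /A /= !in_itv /= -!ler_norml.
Qed.

(** The lower bound [mu] on the annulus forces the minimum [z] over the square into the open disc of
    radius [rho]. If [f z] were nonzero, minimality would kill all Taylor coefficients at [z] of
    orders 1 to [n.+1], leaving [f] too close to [f z] to reach [mu] on the circle of radius
    [rho]. *)
Lemma zero_exists f n (B rho mu : R) : S n.+2 B f -> 0 < rho -> rho <= 4^-1 ->
  (forall w, D w -> rho <= nm (w - k0) -> nm (w - k0) <= 2 * rho -> mu <= nm (f w)) ->
  nm (f k0) + (2 * rho) ^+ n.+2 * B < mu ->
  exists z, nm (z - k0) < rho /\ f z = 0.
Proof.
move=> fS r0 r4 fmu f0.
have B0 : 0 <= B by apply: le_trans (divdiff_normc fS half_disc_center); rewrite nm_ge0.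
have flip w z : D w -> D z -> nm (f w - f z) <= B * nm (w - z).
  by move=> Dw Dz; exact: divdiff_lip fS Dw Dz.
have [z [z1 z2 zmin]] := square_min B0 r0 r4 flip.
have fzk0 : nm (f z) <= nm (f k0).
  by apply: zmin; rewrite subrr /= normr0 ltW.
have pos : 0 <= (2 * rho) ^+ n.+2 * B by rewrite mulr_ge0 // exprn_ge0 // mulr_ge0 // ltW.
have z2r : nm (z - k0) <= 2 * rho by apply: le_trans (nm_ReIm _) _; lra.
have Dz : D z by rewrite /half_disc; lra.
have zr : nm (z - k0) < rho.
  by rewrite ltNge; apply/negP => rz; have := fmu _ Dz rz z2r; lra.
exists z; split=> //; apply/eqP/negP => /negP fz.
pose r := rho - nm (z - k0).
have rpos : 0 < r by rewrite subr_gt0.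
have near w : nm (w - z) < r -> nm (w - k0) < rho.
  move=> wr; have -> : w - k0 = (w - z) + (z - k0) by ring.
  by apply: le_lt_trans (nmD _ _) _; rewrite /r in wr; lra.
have nodec w : nm (w - z) < r -> nm (f z) <= nm (f w).
  by move=> /near wr; apply: zmin; apply: le_trans (ltW wr); [exact: nm_Re|exact: nm_Im].
have step j : (j <= n.+1)%N -> exists G, S (n.+1 - j) B G /\
    forall w, D w -> f w - f z = (w - z) ^+ j.+1 * G w.
  elim: j => [|j IH] jn; first by rewrite subn0; exact: divdiff_quot.
  have [G [GS Gq]] := IH (ltnW jn).
  rewrite subSn // in GS.
  have [G' [GS' Gq']] := divdiff_quot GS Dz.
  exists G'; split=> // w Dw; rewrite Gq //.
  (* A nonzero leading coefficient [G z] would let [modulus_decrease] go below the minimum, so one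
     more factor [w - z] splits off. *)
  suff Gz : G z = 0 by rewrite [in RHS]exprSr -mulrA -Gq' // Gz subr0.
  apply/eqP/negP => /negP Gz.
  have Gloc y : nm (y - z) < r -> f y - f z = (y - z) ^+ j.+1 * G y /\
      nm (G y - G z) <= B * nm (y - z).
    move=> yr; have Dy : D y by have := near _ yr; rewrite /half_disc; lra.
    by split; [exact: Gq|exact: divdiff_lip GS Dy Dz].
  have [y [/nodec fzy]] := modulus_decrease (ltn0Sn j) rpos B0 fz Gz Gloc.
  by rewrite ltNge fzy.
have [G [GS Gq]] := step n.+1 (leqnn _).
(* A point on the inner circle of the annulus, where both [mu] and the remainder bound apply. *)
pose w := k0 + rho%:C.
have wk : nm (w - k0) = rho by rewrite /w addrC addKr nmR gtr0_norm.
have Dw : D w by rewrite /half_disc wk; lra.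
have := fmu _ Dw; rewrite wk lexx => /(_ isT); rewrite mulr_natl mulr2n lerDl ltW // => /(_ isT).
have -> : f w = f z + (w - z) ^+ n.+2 * G w by rewrite -Gq //; ring.
have wz : nm (w - z) <= 2 * rho.
  have -> : w - z = (w - k0) - (z - k0) by ring.
  by apply: le_trans (nmD _ _) _; rewrite nmN wk; lra.
have h : nm ((w - z) ^+ n.+2 * G w) <= (2 * rho) ^+ n.+2 * B.
  apply: nmM2 (divdiff_normc GS Dw); rewrite nmX lerXn2r ?nnegrE ?nm_ge0 //.
  by rewrite mulr_ge0 // ltW.
have := nmD (f z) ((w - z) ^+ n.+2 * G w); lra.
Qed.

Lemma smooth_center n : smooth n (fun k => k - k0).
Proof. by apply: (@smooth_sub _ _ _ _ (2^-1)). Qed.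

Lemma smooth_root n z : smooth n (fun k => k - z).
Proof.
apply: smooth_ext (smooth_add (smooth_center n) (smooth_cst _ n (k0 - z))) => w _.
by rewrite addrA subrK.
Qed.

(** Roots are listed with repetition. The factorization holds on the whole disc of radius 1/2, the
    absence of zeros of [h] only within [delta]; order 2 for [h] is what differentiability needs. *)
Definition factors_at f (delta : R) d := exists zs : seq C,
  [/\ size zs = d, forall z, z \in zs -> nm (z - k0) < delta &
   exists h, [/\ smooth 2 h, forall k, D k -> f k = (\prod_(z <- zs) (k - z)) * h k &
    forall k, nm (k - k0) < delta -> h k != 0]].

(** Induction on [d]. With [z] a zero of [f = (k - k0) ^+ d.+1 * g + e], and [q], [e1] the divided
    differences at [z] of [(k - k0) ^+ d * g] and of [e], one gets [f k = (k - z) * ((k - k0) ^+ d *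
    g k + e' k)] where [e' = (z - k0) * q + e1]. Each division uses up one order of [e]. *)
Lemma hurwitz_factor m g (c delta : R) : smooth m g -> 0 < c -> 0 < delta -> delta <= 2^-1 ->
  (forall k, nm (k - k0) < delta -> c <= nm (g k)) ->
  forall d, (d.+2 <= m)%N -> exists eta, 0 < eta /\
    forall e, S d.+2 eta e -> factors_at (fun k => (k - k0) ^+ d * g k + e k) delta d.
Proof.
move=> gS c0 de0 deh gc; elim=> [|d IH] dm.
  (* For [d = 0] no root is extracted: [g + e] stays above [c / 2] in modulus. *)
  exists (c / 2); split=> [|e eS]; first by rewrite divr_gt0.
  exists [::]; split=> //.
  exists (fun k => (k - k0) ^+ 0 * g k + e k); split.
  - apply: smooth_add; last exact: divdiff_boundedW half_disc_center eS.
    by apply: smooth_ext (smooth_leq dm gS) => k _; rewrite expr0 mul1r.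
  - by move=> k _; rewrite big_nil mul1r.
  - move=> k kd; rewrite -nm_gt0 expr0 mul1r; have := nm_sub_ge (g k) (e k).
    have Dk : D k by rewrite /half_disc; lra.
    by have := gc _ kd; have := divdiff_normc eS Dk; lra.
have [eta1 [eta10 etaP]] := IH (ltnW dm).
have pS j : smooth d.+3 (fun k => (k - k0) ^+ j * g k).
  apply: smooth_mul; last exact: smooth_leq dm gS.
  exact/smooth_exp/smooth_center.
have [B1 B10 p1] := pS d; have [B2 B20 p2] := pS d.+1.
(* In order, the bounds beyond [s <= 1] serve to control the remainder in [zero_exists], to keep
   [(z - k0) * q] below [eta1 / 2], to keep the square in the disc, and to keep the annulus where
   [g] is bounded below by [c]. *)
have [rho [r0 _ ra [r1 r4 r2]]] : exists s : R, [/\ 0 < s, s <= 1, s * (2 ^+ d.+2 * (B2 + 1)) < c / 4 &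
    [/\ s * B1 < eta1 / 2, s <= 4^-1 & 2 * s < delta]].
  pose a := 2 ^+ d.+2 * (B2 + 1).
  have a0 : 0 <= a by rewrite mulr_ge0 ?exprn_ge0 // addr_ge0.
  have [||s [s0 s1 sa sb]] := @small_scale a B1 (c / 4) (eta1 / 2) a0 B10; [lra|lra|].
  exists (Num.min s (Num.min 4^-1 (delta / 3))).
  have le1 : Num.min s (Num.min 4^-1 (delta / 3)) <= s by rewrite ge_min lexx.
  have le2 : Num.min s (Num.min 4^-1 (delta / 3)) <= 4^-1 by rewrite !ge_min lexx orbT.
  have le3 : Num.min s (Num.min 4^-1 (delta / 3)) <= delta / 3 by rewrite !ge_min lexx !orbT.
  split; [by rewrite !lt_min s0 invr_gt0 ltr0n divr_gt0|lra| |split=> //; [|lra]].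
    by apply: le_lt_trans sa; rewrite ler_wpM2r.
  by apply: le_lt_trans sb; rewrite ler_wpM2r.
(* A lower bound for the unperturbed term on the annulus. With [eta <= M / 8], the value at [k0]
   plus the remainder is below [M / 8 + M / 4], hence below [M - eta]. *)
pose M := rho ^+ d.+1 * c.
have M0 : 0 < M by rewrite mulr_gt0 ?exprn_gt0.
pose eta := Num.min 1 (Num.min (eta1 / 2) (M / 8)).
have eta_1 : eta <= 1 by rewrite ge_min lexx.
have eta_2 : eta <= eta1 / 2 by rewrite !ge_min lexx orbT.
have eta_3 : eta <= M / 8 by rewrite !ge_min lexx !orbT.
exists eta; split=> [|e eS]; first by rewrite !lt_min ltr01 !divr_gt0.
have Dk0 := half_disc_center.
pose f k := (k - k0) ^+ d.+1 * g k + e k.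
have fS : S d.+2 (B2 + 1) f.
  by apply: divdiff_pred; apply: divdiff_add p2 _; exact: divdiff_weaken eS.
have fmu w : D w -> rho <= nm (w - k0) -> nm (w - k0) <= 2 * rho -> M - eta <= nm (f w).
  move=> Dw rw wr; have wd : nm (w - k0) < delta by lra.
  have h1 : M <= nm ((w - k0) ^+ d.+1 * g w).
    rewrite nmM nmX ler_pM ?exprn_ge0 ?(ltW r0) ?(ltW c0) ?gc //.
    by rewrite lerXn2r ?nnegrE ?nm_ge0 // ltW.
  have := nm_sub_ge ((w - k0) ^+ d.+1 * g w) (e w).
  by have := divdiff_normc eS Dw; rewrite /f; lra.
have fk0 : nm (f k0) + (2 * rho) ^+ d.+2 * (B2 + 1) < M - eta.
  have -> : (2 * rho) ^+ d.+2 * (B2 + 1) = rho ^+ d.+1 * (rho * (2 ^+ d.+2 * (B2 + 1))).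
    by rewrite exprMn (exprS rho d.+1); move: (rho ^+ d.+1) (2 ^+ d.+2) => X Y; ring.
  have h1 : rho ^+ d.+1 * (rho * (2 ^+ d.+2 * (B2 + 1))) < M / 4.
    by rewrite /M -mulrA ltr_pM2l ?exprn_gt0.
  have := divdiff_normc eS Dk0; rewrite /f subrr expr0n mul0r add0r; lra.
have [z [zr fz]] := zero_exists fS r0 r4 fmu fk0.
have Dz : D z by rewrite /half_disc; lra.
have [e1 [e1S e1q]] := divdiff_quot eS Dz; have [q [qS qq]] := divdiff_quot p1 Dz.
pose e' k := (z - k0) * q k + e1 k.
have e'S : S d.+2 eta1 e'.
  have := divdiff_add (divdiff_scale (ltW zr) qS) e1S; apply: divdiff_weaken; lra.
have [zs [zsd zsP [h [hS hq h0]]]] := etaP _ e'S.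
exists (z :: zs); split; first by rewrite /= zsd.
  by move=> y; rewrite inE => /predU1P[->|/zsP//]; lra.
exists h; split=> // k Dk; rewrite big_cons -mulrA -hq //.
rewrite /e' mulrDr [in RHS]mulrDr [(k - z) * ((z - k0) * _)]mulrCA -qq // -e1q //.
have -> : e k - e z = f k - f z - ((k - k0) ^+ d.+1 * g k - (z - k0) ^+ d.+1 * g z).
  by rewrite /f; ring.
by rewrite fz /f !exprS; ring.
Qed.

Lemma norm_ltC (z : C) (x : R) : (`|z| < x%:C) = (nm z < x).
Proof. by rewrite norm_normc ltcR. Qed.

(** The divided difference [q] at [w] still has order 1, so it is Lipschitz; the derivative is
    therefore [q w]. *)
Lemma smooth_cdifferentiable f w : smooth 2 f -> nm (w - k0) < 2^-1 -> cdifferentiable f w.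
Proof.
move=> [B B0 fS] wh; have Dw : D w by exact: ltW.
have [q [qS qq]] := divdiff_quot fS Dw.
exists (q w) => e e0.
have r0 : 0 < 2^-1 - nm (w - k0) by rewrite subr_gt0.
have [s [s0 s1 sr se]] := small_scale ler01 B0 r0 e0.
exists s; split=> // u u0; rewrite norm_ltC => us.
have Dwu : D (w + u).
  rewrite /half_disc (_ : w + u - k0 = (w - k0) + u); last by ring.
  by apply: le_trans (nmD _ _) _; lra.
have wu : w + u - w = u by ring.
rewrite norm_ltC qq // wu mulrAC mulfV // mul1r.
apply: le_lt_trans (divdiff_lip qS Dwu Dw) _; rewrite wu mulrC; apply: le_lt_trans se.
by rewrite ler_wpM2r // ltW.
Qed.

Lemma prod_root_count (zs : seq C) z w :
  \prod_(y <- zs) (w - y) =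
  (w - z) ^+ count_mem z zs * \prod_(y <- zs | y != z) (w - y).
Proof.
elim: zs => [|y zs IH]; first by rewrite !big_nil mulr1.
rewrite !big_cons IH /=; have [->|yz] := eqVneq y z.
  by rewrite add1n exprS mulrA.
by rewrite add0n mulrCA.
Qed.

Lemma sum_count_undup (T : eqType) (s : seq T) :
  sumn [seq count_mem x s | x <- undup s] = size s.
Proof.
rewrite sumnE big_map -sum1_size -[RHS]big_undup_iterop_count /=.
by apply: eq_bigr => x _; rewrite Monoid.iteropE iter_addn_0 mul1n.
Qed.

(** The multiplicity of a zero is its number of occurrences in [zs]; the other root factors together
    with [h] form the nonvanishing cofactor. *)
Lemma factors_zeros_mult_sum f (delta : R) d : delta <= 2^-1 ->
  factors_at f delta d -> zeros_mult_sum f k0 delta d.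
Proof.
move=> de [zs [zsd zsP [h [hS hq h0]]]].
exists [seq (z, count_mem z zs) | z <- undup zs].
have fstE : [seq p.1 | p <- [seq (z, count_mem z zs) | z <- undup zs]] = undup zs.
  by rewrite -map_comp map_id.
rewrite fstE; split; first exact: undup_uniq.
split; [|split].
- move=> _ /mapP[z + ->] /=; rewrite mem_undup => zzs; have zd := zsP _ zzs.
  rewrite norm_ltC; split=> //; split; first by rewrite -has_count has_pred1.
  (* This radius keeps the neighbourhood of [z] inside the disc of radius 1/2, where the
     factorization holds. *)
  exists (fun w => (\prod_(y <- zs | y != z) (w - y)) * h w), (2^-1 - nm (z - k0)).
  split; [lra|split].
    rewrite mulf_neq0 ?h0 //; rewrite prodf_seq_neq0; apply/allP => y _.
    by apply/implyP; rewrite subr_eq0 eq_sym.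
  move=> w; rewrite norm_ltC => wz.
  have wk : nm (w - k0) < 2^-1.
    rewrite (_ : w - k0 = (w - z) + (z - k0)); last by ring.
    by apply: le_lt_trans (nmD _ _) _; lra.
  split; first by rewrite hq ?mulrA -?prod_root_count //; exact: ltW.
  apply: smooth_cdifferentiable => //; apply: smooth_mul => //.
  by apply: smooth_prod => y; exact: smooth_root.
- move=> k; rewrite norm_ltC => kd; rewrite hq; last by rewrite /half_disc; lra.
  move/eqP; rewrite mulf_eq0 (negbTE (h0 _ kd)) orbF prodf_seq_eq0 mem_undup.
  by case/hasP => y yzs /=; rewrite subr_eq0 => /eqP ->.
- by rewrite -map_comp -zsd -sum_count_undup.
Qed.

(** A metric form of the order of a zero. The cofactor given by [zero_order] is merely
    differentiable near [k0], with no divided difference bounds; this form allows a better cofactor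
    to be rebuilt. *)
Definition zero_growth f d := exists r c K : R, [/\ 0 < r, 0 < c, 0 <= K &
  forall w, 0 < nm (w - k0) < r ->
    c * nm (w - k0) ^+ d <= nm (f w) <= K * nm (w - k0) ^+ d].

Lemma zero_order_growth f d : zero_order f k0 d -> zero_growth f d.
Proof.
move=> [g [r [r0 [g0 gP]]]].
have [L gL] : cdifferentiable g k0.
  by have [//|] := gP k0; rewrite ?subrr ?normr0 -?(rmorph0 (real_complex R)) ?ltcR.
have [s [s0 sP]] := gL 1 ltr01.
have gk0 : 0 < nm (g k0) by rewrite nm_gt0.
have g2 : 0 < nm (g k0) / 2 by rewrite divr_gt0.
have [t [t0 t1 tL _]] := small_scale (addr_ge0 (nm_ge0 L) ler01) ler01 g2 ltr01.
exists (Num.min r (Num.min s t)), (nm (g k0) / 2), (2 * nm (g k0)).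
split; rewrite ?divr_gt0 ?mulr_ge0 ?(ltW gk0) ?lt_min ?r0 ?s0 //.
move=> w; rewrite !lt_min => /andP[w0 /andP[wr /andP[ws wt]]].
have [|-> _] := gP w; first by rewrite norm_ltC.
have := sP (w - k0); rewrite -nm_gt0 norm_ltC => /(_ w0 ws).
rewrite [k0 + _]addrC subrK norm_ltC => hL.
have w0' : w - k0 != 0 by rewrite -nm_gt0.
have hb : nm (g w - g k0) <= (nm L + 1) * nm (w - k0).
  rewrite (_ : g w - g k0 = ((g w - g k0) / (w - k0) - L + L) * (w - k0)); last first.
    by rewrite subrK divfK.
  apply: nmM2 => //; rewrite addrC; apply: nmD2 => //; exact: ltW.
have hb2 : nm (g w - g k0) <= nm (g k0) / 2.
  apply: le_trans hb _; apply: le_trans (ltW tL); rewrite mulrC ler_wpM2r //.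
    by rewrite addr_ge0 ?nm_ge0.
  exact: ltW.
have := nm_dist (g w) (g k0); rewrite ler_norml => /andP[d1 d2].
rewrite nmM nmX [_ ^+ d * _]mulrC !ler_pM2r ?exprn_gt0 //.
by apply/andP; split; lra.
Qed.

Lemma exists_near (r : R) : 0 < r -> exists w, [/\ D w, 0 < nm (w - k0) & nm (w - k0) < r].
Proof.
move=> r0; have h0 : (0 : R) < 2^-1 by rewrite invr_gt0.
have [s [s0 s1 sr sh]] := small_scale ler01 ler01 r0 h0.
exists (k0 + s%:C).
have -> : nm (k0 + s%:C - k0) = s by rewrite addrC addKr nmR gtr0_norm.
by split; rewrite ?/half_disc; [rewrite addrC addKr nmR gtr0_norm //| |]; lra.
Qed.

(** While the exponent is positive, the upper growth bound forces [f k0 = 0], and the divided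
    difference at [k0] has growth exponent one less. At exponent 0 the lower bound rules out a zero
    at [k0]. *)
Lemma zero_growth_factor m d f (B : R) : S (m.+1 + d) B f -> zero_growth f d ->
  exists g, [/\ S m.+1 B g, g k0 != 0 & forall k, D k -> f k = (k - k0) ^+ d * g k].
Proof.
have Dk0 := half_disc_center.
elim: d f => [|d IH] f; rewrite ?addn0 ?addnS => fS [r [c [K [r0 c0 K0 fP]]]].
  exists f; split=> // [|k _]; last by rewrite expr0 mul1r.
  apply/negP => /eqP f0.
  have B0 : 0 <= B by apply: le_trans (divdiff_normc fS Dk0); rewrite nm_ge0.
  have [s [s0 _ sr sB]] := small_scale ler01 B0 r0 c0.
  have [w [Dw w0 ws]] := exists_near s0.
  have := fP w; rewrite w0 expr0 !mulr1 => /(_ _)/andP[|]; first by lra.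
  have := divdiff_lip fS Dw Dk0; rewrite f0 subr0.
  have : B * nm (w - k0) <= s * B by rewrite mulrC ler_wpM2r // ltW.
  lra.
have [g [gS gq]] := divdiff_quot fS Dk0.
have f0 : f k0 = 0.
  apply/eqP; apply: contraT; rewrite -nm_gt0 => f0.
  have B0 : 0 <= B by apply: le_trans (divdiff_normc fS Dk0); rewrite nm_ge0.
  have [s [s0 s1 sr sB]] := small_scale ler01 (addr_ge0 B0 K0) r0 f0.
  have [w [Dw w0 ws]] := exists_near s0.
  have /andP[_ fw] : c * nm (w - k0) ^+ d.+1 <= nm (f w) <= K * nm (w - k0) ^+ d.+1.
    by apply: fP; rewrite w0 /=; lra.
  have fl := divdiff_lip fS Dw Dk0.
  have h1 : K * nm (w - k0) ^+ d.+1 <= K * nm (w - k0).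
    rewrite ler_wpM2l // exprS ler_piMr ?nm_ge0 // exprn_ile1 ?nm_ge0 //; lra.
  have h2 : (B + K) * nm (w - k0) <= s * (B + K).
    by rewrite mulrC ler_wpM2r ?addr_ge0 // ltW.
  have := nm_dist (f w) (f k0); rewrite ler_norml => /andP[h3 _].
  rewrite mulrDl in h2; lra.
have fg k : D k -> f k = (k - k0) * g k by move=> Dk; rewrite -gq // f0 subr0.
have [h [hS h0 hq]] : exists h, [/\ S m.+1 B h, h k0 != 0 &
    forall k, D k -> g k = (k - k0) ^+ d * h k].
  apply: IH; first by [].
  exists (Num.min r 2^-1), c, K; split=> //; first by rewrite lt_min r0 invr_gt0 ltr0n.
  move=> w; rewrite lt_min => /andP[w0 /andP[wr wh]].
  have := fP w; rewrite w0 wr fg; last exact: ltW.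
  move=> /(_ isT); rewrite nmM !exprS ![_ * (nm (w - k0) * _)]mulrCA.
  by rewrite !ler_pM2l.
exists h; split=> // k Dk; rewrite fg // hq // exprS mulrA //.
Qed.

(** The family is compared with [f] in the classes of all orders, which replaces uniform convergence
    of holomorphic functions; the parameter space enters only through [near]. *)
Theorem hurwitz (T : Type) (near : R -> T -> Prop) (F : T -> C -> C) f d :
  (forall n, smooth n f) ->
  (forall n (eta : R), 0 < eta -> exists eps : R, 0 < eps /\
     forall t, near eps t -> S n eta (fun k => F t k - f k)) ->
  zero_order f k0 d ->
  exists delta0 : R, 0 < delta0 /\ forall delta, 0 < delta -> delta <= delta0 ->
    exists eps : R, 0 < eps /\ forall t, near eps t -> zeros_mult_sum (F t) k0 delta d.
Proof.
move=> fs Ff /zero_order_growth fd.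
have Dk0 := half_disc_center.
(* The divisions by [k - k0] use [d] orders; the cofactor must retain [d.+2] for
   [hurwitz_factor]. *)
have [B B0 fS] := fs (d.+2 + d)%N.
have [g [gS g0 fg]] := zero_growth_factor fS fd.
have gk0 : 0 < nm (g k0) / 2 by rewrite divr_gt0 // nm_gt0.
have h0 : (0 : R) < 2^-1 by rewrite invr_gt0.
have [s [s0 s1 sB sh]] := small_scale B0 ler01 gk0 h0.
exists s; split=> // delta de0 des.
have de2 : delta <= 2^-1 by lra.
have gc k : nm (k - k0) < delta -> nm (g k0) / 2 <= nm (g k).
  move=> kd; have Dk : D k by rewrite /half_disc; lra.
  have := divdiff_lip gS Dk Dk0; have := nm_dist (g k) (g k0); rewrite ler_norml => /andP[h1 _] h2.
  have : B * nm (k - k0) <= s * B by rewrite mulrC ler_wpM2r //; lra.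
  lra.
have gsm : smooth d.+2 g by exists B.
have [eta [eta0 etaP]] := hurwitz_factor gsm gk0 de0 de2 gc (leqnn _).
have [eps [eps0 epsP]] := Ff d.+2 eta eta0.
exists eps; split=> // t /epsP/etaP [zs [zsd zsP [h [hS hq hn]]]].
apply: factors_zeros_mult_sum => //; exists zs; split=> //; exists h; split=> // k Dk.
by rewrite -hq // -fg // addrC subrK.
Qed.

End Hurwitz.

(** * Families depending on the length perturbation, and their convergence to the unperturbed
    function *)

Section Families.
Variables (R : realType) (N : nat) (k0 : R[i]).
Local Notation C := R[i].
Local Notation D := (half_disc k0).
Local Notation S := (divdiff_bounded D).
Local Notation smooth := (divdiff_smooth D).
Implicit Types (F G : 'rV[R]_N -> C -> C) (f g : C -> C) (t : 'rV[R]_N) (c : C).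

Definition in_ball (eps : R) t := \sum_(j < N) t 0 j ^+ 2 < eps ^+ 2.

Lemma in_ball_le a b t : 0 < a -> a <= b -> in_ball a t -> in_ball b t.
Proof.
move=> a0 ab /lt_le_trans; apply.
by rewrite lerXn2r ?nnegrE // ltW // (lt_le_trans a0).
Qed.

Lemma in_ball_coord eps t j : 0 < eps -> in_ball eps t -> `|t 0 j| < eps.
Proof.
move=> e0 tb; rewrite -(@ltr_pXn2r _ 2) ?nnegrE ?(ltW e0) // real_normK ?num_real //.
apply: le_lt_trans tb; rewrite (bigD1 j) //= lerDl; apply: sumr_ge0 => i _.
exact: sqr_ge0.
Qed.

(** The radius may depend on both [n] and [eta]. Smoothness of the limit is included because the
    product rule needs bounds for it. *)
Definition converging F f := (forall n, smooth n f) /\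
  forall n (eta : R), 0 < eta -> exists eps : R, 0 < eps /\
    forall t, in_ball eps t -> S n eta (fun k => F t k - f k).

Lemma converging_ext F G f g : (forall t k, F t k = G t k) -> (forall k, f k = g k) ->
  converging F f -> converging G g.
Proof.
by move=> /(_ _)/funext FG /funext <-; rewrite (_ : G = F) //; apply/funext => t; rewrite FG.
Qed.

Lemma converging_const f : (forall n, smooth n f) -> converging (fun=> f) f.
Proof.
move=> fs; split=> // n eta e0; exists 1; split=> // t _.
by apply: (@divdiff_ext _ _ _ _ (fun=> 0)) => [w _|]; rewrite ?subrr //; apply: divdiff_cst; rewrite nm0 ltW.
Qed.

Lemma converging_cst c : converging (fun _ _ => c) (fun=> c).
Proof. by apply: converging_const => n; exact: smooth_cst. Qed.

Lemma converging_add F G f g : converging F f -> converging G g ->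
  converging (fun t k => F t k + G t k) (fun k => f k + g k).
Proof.
move=> [fs Ff] [gs Gg]; split=> [n|n eta e0]; first exact: smooth_add.
have e2 : 0 < eta / 2 by rewrite divr_gt0.
have [a [a0 aP]] := Ff n _ e2; have [b [b0 bP]] := Gg n _ e2.
have m0 : 0 < Num.min a b by rewrite lt_min a0.
exists (Num.min a b); split=> // t tm.
have ta : in_ball a t by apply: in_ball_le m0 _ tm; rewrite ge_min lexx.
have tb : in_ball b t by apply: in_ball_le m0 _ tm; rewrite ge_min lexx orbT.
rewrite (splitr eta); apply: divdiff_ext (divdiff_add (aP _ ta) (bP _ tb)) => k _.
by rewrite opprD addrACA.
Qed.

Lemma converging_mul F G f g : converging F f -> converging G g ->
  converging (fun t k => F t k * G t k) (fun k => f k * g k).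
Proof.
move=> [fs Ff] [gs Gg]; split=> [n|n eta e0]; first exact: smooth_mul.
have [A A0 fA] := fs n; have [B B0 gB] := gs n.
(* The difference of products is [(F - f) * (G - g) + f * (G - g) + (F - f) * g]. With both errors
   at most [s <= 1], its bound is at most [s] times this constant. *)
have K0 : 0 <= 2 ^+ n * (1 + A + B) by rewrite mulr_ge0 ?exprn_ge0 // !addr_ge0.
have [s [s0 s1 sK _]] := small_scale K0 ler01 e0 ltr01.
have [a [a0 aP]] := Ff n _ s0; have [b [b0 bP]] := Gg n _ s0.
have m0 : 0 < Num.min a b by rewrite lt_min a0.
exists (Num.min a b); split=> // t tm.
have ta : in_ball a t by apply: in_ball_le m0 _ tm; rewrite ge_min lexx.
have tb : in_ball b t by apply: in_ball_le m0 _ tm; rewrite ge_min lexx orbT.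
have sp := ltW s0.
have := divdiff_add (divdiff_add (divdiff_mul sp sp (aP _ ta) (bP _ tb)) (divdiff_mul A0 sp fA (bP _ tb)))
  (divdiff_mul sp B0 (aP _ ta) gB).
move/divdiff_ext => /(_ (fun k => F t k * G t k - f k * g k)) h.
apply: divdiff_weaken (h _) => [|k _]; last by ring.
apply: le_trans (ltW sK); rewrite -!mulrDr mulrCA ler_wpM2l ?exprn_ge0 //.
have : s * s <= s * 1 by rewrite ler_wpM2l.
lra.
Qed.

Lemma converging_sum (I : Type) (r : seq I) (P : pred I)
    (F : I -> 'rV[R]_N -> C -> C) (f : I -> C -> C) :
  (forall i, converging (F i) (f i)) ->
  converging (fun t k => \sum_(i <- r | P i) F i t k) (fun k => \sum_(i <- r | P i) f i k).
Proof.
move=> Ff; elim: r => [|i r IH].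
  by apply: converging_ext (converging_cst 0) => *; rewrite big_nil.
case Pi: (P i); last by apply: converging_ext IH => *; rewrite big_cons Pi.
by apply: converging_ext (converging_add (Ff i) IH) => *; rewrite big_cons Pi.
Qed.

Lemma converging_prod (I : Type) (r : seq I) (P : pred I)
    (F : I -> 'rV[R]_N -> C -> C) (f : I -> C -> C) :
  (forall i, converging (F i) (f i)) ->
  converging (fun t k => \prod_(i <- r | P i) F i t k) (fun k => \prod_(i <- r | P i) f i k).
Proof.
move=> Ff; elim: r => [|i r IH].
  by apply: converging_ext (converging_cst 1) => *; rewrite big_nil.
case Pi: (P i); last by apply: converging_ext IH => *; rewrite big_cons Pi.
by apply: converging_ext (converging_mul (Ff i) IH) => *; rewrite big_cons Pi.
Qed.

Lemma converging_det n (A : 'rV[R]_N -> C -> 'M[C]_n) (B : C -> 'M[C]_n) :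
  (forall i j, converging (fun t k => A t k i j) (fun k => B k i j)) ->
  converging (fun t k => \det (A t k)) (fun k => \det (B k)).
Proof.
(* The determinant unfolds to the Leibniz sum over permutations. *)
move=> AB; apply: converging_sum => s; apply: converging_mul; first exact: converging_cst.
by apply: converging_prod => i; exact: AB.
Qed.

Lemma converging_mulmx m n p (A : 'M[C]_(m, n))
    (X : 'rV[R]_N -> C -> 'M[C]_(n, p)) (Y : C -> 'M[C]_(n, p)) :
  (forall i j, converging (fun t k => X t k i j) (fun k => Y k i j)) ->
  forall i j, converging (fun t k => (A *m X t k) i j) (fun k => (A *m Y k) i j).
Proof.
move=> XY i j.
have h := @converging_sum _ (index_enum 'I_n) xpredT (fun l t k => A i l * X t k l j)
  (fun l k => A i l * Y k l j).
apply: converging_ext (h _) => [*|*|l]; rewrite ?mxE //.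
by apply: converging_mul => //; exact: converging_cst.
Qed.

Lemma converging_id : converging (fun _ k => k) id.
Proof.
apply: converging_const => n.
apply: smooth_ext (smooth_add (smooth_center k0 n) (smooth_cst _ n k0)) => k _.
by rewrite subrK.
Qed.

(** With [u = c * t_j], the difference [cexp (u * k) - 1] equals [cexp (u * k0) * (cexp (u * (k -
    k0)) - 1) + (cexp (u * k0) - 1)]: a small power series centred at [k0] plus a small constant. *)
Lemma converging_cexp1 c j :
  converging (fun t k => cexp (c * (t 0 j)%:C * k)) (fun=> 1).
Proof.
split=> [n|n eta e0]; first exact: smooth_cst.
(* The 5 bounds [nm (cexp (u * k0))], namely [1 + 8 / 2] once [nm (u * k0) <= 2^-1]; the 8 is that
   of [cexp_sub1_le]. *)
pose K := 5 * 4 ^+ n.+1 + 8 * nm k0.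
have K0 : 0 <= K by rewrite addr_ge0 ?mulr_ge0 ?exprn_ge0 ?nm_ge0.
have h0 : (0 : R) < 2^-1 by rewrite invr_gt0.
have [s [s0 s1 sk sK]] := small_scale (nm_ge0 k0) K0 h0 e0.
have [eps [eps0 _ epsc _]] := small_scale (nm_ge0 c) ler01 s0 ltr01.
exists eps; split=> // t /(in_ball_coord j eps0) tj.
set u := c * (t 0 j)%:C.
have us : nm u <= s.
  rewrite nmM nmR; apply: le_trans (ltW epsc); rewrite mulrC ler_wpM2r ?nm_ge0 //.
  exact: ltW.
have u1 : nm u <= 1 by lra.
have uk : nm (u * k0) <= s * nm k0 by rewrite nmM ler_wpM2r ?nm_ge0.
have uk2 : nm (u * k0) <= 2^-1 by lra.
have e1 := cexp_sub1_le uk2.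
have e5 : nm (cexp (u * k0)) <= 5.
  rewrite -(subrK 1 (cexp _)); apply: le_trans (nmD _ _) _; rewrite nm1; lra.
have := divdiff_add (divdiff_scale e5 (cexp_sub1_bounded n k0 u1)) (divdiff_cst D n e1).
move/divdiff_ext => /(_ (fun k => cexp (u * k) - 1)) h; apply: divdiff_weaken (h _) => [|k _].
  apply: le_trans (ltW sK); rewrite /K mulrDr mulrA; apply: lerD.
    by rewrite mulrC ler_wpM2r ?mulr_ge0 ?exprn_ge0.
  by rewrite mulrCA ler_wpM2l.
rewrite mulrBr mulr1 addrA subrK -cexpD; congr (cexp _ - 1); ring.
Qed.

Lemma converging_cexp a c j :
  converging (fun t k => cexp ((a + c * (t 0 j)%:C) * k)) (fun k => cexp (a * k)).
Proof.
have h := converging_const (fun n => cexp_smooth n k0 a).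
apply: converging_ext (converging_mul h (converging_cexp1 c j)) => [t k|k].
  by rewrite -cexpD mulrDl.
by rewrite mulr1.
Qed.

(** * Convergence of the trigonometric entries, the coupling blocks and the secular determinant *)

Variable l : 'I_N -> R.

Lemma converging_csin j :
  converging (fun t k => csin (k * (perturbed_lengths l t j)%:C))
             (fun k => csin (k * (l j)%:C)).
Proof.
have h1 := converging_cexp ('i * (l j)%:C) ('i * (l j)%:C) j.
have h2 := converging_cexp (- ('i * (l j)%:C)) (- ('i * (l j)%:C)) j.
have h := converging_mul (converging_add h1 (converging_mul (converging_cst (-1)) h2))
  (converging_cst (2 * 'i)^-1).
apply: converging_ext h => [t k|k]; rewrite csinE mulN1r; congr ((cexp _ - cexp _) / _);
  rewrite /perturbed_lengths ?rmorphM ?rmorphD ?rmorph1 /=; ring.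
Qed.

Lemma converging_ccos j :
  converging (fun t k => ccos (k * (perturbed_lengths l t j)%:C))
             (fun k => ccos (k * (l j)%:C)).
Proof.
have h1 := converging_cexp ('i * (l j)%:C) ('i * (l j)%:C) j.
have h2 := converging_cexp (- ('i * (l j)%:C)) (- ('i * (l j)%:C)) j.
have h := converging_mul (converging_add h1 h2) (converging_cst 2^-1).
apply: converging_ext h => [t k|k]; rewrite ccosE; congr ((cexp _ + cexp _) / _);
  rewrite /perturbed_lengths ?rmorphM ?rmorphD ?rmorph1 /=; ring.
Qed.

Lemma converging_blockdiag2 (A : 'rV[R]_N -> C -> 'I_N -> bool -> bool -> C)
    (B : C -> 'I_N -> bool -> bool -> C) :
  (forall j a b, converging (fun t k => A t k j a b) (fun k => B k j a b)) ->
  forall i j, converging (fun t k => blockdiag2 (A t k) i j) (fun k => blockdiag2 (B k) i j).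
Proof.
move=> AB i j.
(* The tests depend only on the indices, so once the entry is unfolded they can be decided uniformly
   in [t] and [k]. *)
apply: (@converging_ext (fun t k => if ((i %/ 2) == (j %/ 2))%N
     then (if (i %/ 2 < N)%N =P true is ReflectT H
           then A t k (Ordinal H) (odd i) (odd j) else 0) else 0) _
   (fun k => if ((i %/ 2) == (j %/ 2))%N
     then (if (i %/ 2 < N)%N =P true is ReflectT H
           then B k (Ordinal H) (odd i) (odd j) else 0) else 0)).
- by move=> t k; rewrite mxE.
- by move=> k; rewrite mxE.
case: (_ == _); last exact: converging_cst.
by case: (_ =P true) => H; [exact: AB|exact: converging_cst].
Qed.

Lemma converging_block_diag M (A : 'rV[R]_N -> C -> 'M[C]_(2 * N)) (B : C -> 'M[C]_(2 * N))
    (X : 'M[C]_M) :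
  (forall i j, converging (fun t k => A t k i j) (fun k => B k i j)) ->
  forall i j, converging (fun t k => (block_mx (A t k) 0 0 X) i j)
                         (fun k => (block_mx (B k) 0 0 X) i j).
Proof.
move=> AB i j; case: (split_ordP i) => i' ->; case: (split_ordP j) => j' ->.
- by apply: converging_ext (AB i' j') => *; rewrite block_mxEul.
- by apply: converging_ext (converging_cst 0) => *; rewrite block_mxEur mxE.
- by apply: converging_ext (converging_cst 0) => *; rewrite block_mxEdl mxE.
- by apply: converging_ext (converging_cst (X i' j')) => *; rewrite block_mxEdr.
Qed.

Lemma converging_res_det M (U : 'M[C]_(2 * N + M)) :
  converging (fun t => res_det U (perturbed_lengths l t)) (res_det U l).
Proof.
apply: converging_det => i j.
have c1 a b : converging (fun t k => C1mx M (perturbed_lengths l t) k a b)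
                         (fun k => C1mx M l k a b).
  apply: converging_block_diag; apply: converging_blockdiag2 => x [] [] /=.
  - exact: converging_ccos.
  - exact: converging_csin.
  - exact: converging_cst.
  - exact: converging_cst.
have c2 a b : converging (fun t k => C2mx M (perturbed_lengths l t) k a b)
                         (fun k => C2mx M l k a b).
  apply: converging_block_diag; apply: converging_blockdiag2 => x [] [] /=.
  - exact: converging_csin.
  - by apply: converging_ext (converging_mul (converging_cst (-1)) (converging_ccos x)) => *;
       rewrite mulN1r.
  - exact: converging_cst.
  - exact: converging_cst.
have ik := converging_mul (converging_cst 'i) converging_id.
have h := converging_add (converging_mulmx (U - 1%:M) c1 i j)
  (converging_mul ik (converging_mulmx (U + 1%:M) c2 i j)).
by apply: converging_ext h => *; rewrite !mxE.
Qed.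

End Families.

(** The condition on [eps] is [in_ball eps0 eps] unfolded, so [hurwitz] applies with the Euclidean
    ball as [near] and the perturbed secular determinant as family. *)
Theorem theorem5 (R : realType) (N M : nat) (U : 'M[R[i]]_(2 * N + M))
  (l : 'I_N -> R) (k0 : R[i]) (d : nat) :
  unitary_mx U ->
  (forall j, 0 < l j) ->
  \det ((1 - k0) *: drsubmx U - (1 + k0) *: 1%:M) != 0 ->
  (0 < d)%N ->
  zero_order (res_det U l) k0 d ->
  exists delta0 : R, 0 < delta0 /\
    forall delta : R, 0 < delta -> delta <= delta0 ->
      exists eps0 : R, 0 < eps0 /\
        forall eps : 'rV[R]_N, \sum_(j < N) eps 0 j ^+ 2 < eps0 ^+ 2 ->
          zeros_mult_sum (res_det U (perturbed_lengths l eps)) k0 delta d.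
Proof.
move=> _ _ _ _ Uk0; have [sm cv] := converging_res_det k0 l U.
exact: hurwitz sm cv Uk0.
Qed.
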